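(* For every prime $p\in\mathbb{P}_{\mathrm{MP}}$, the stack $\mathcal{M}(\mathrm{PSL}_2(\mathbb{F}_p))^{\mathrm{abs}}_{-2}$ is noncongruence, and hence the same is true of $\mathcal{M}(\mathrm{SL}_2(\mathbb{F}_p))^{\mathrm{abs}}_{-2}$.
   Context: $\mathbb{E}_{\mathrm{bgs}}$ is the set of primes $p$ for which the group generated by permutations of coordinates and $(x,y,z)\mapsto(x,y,xy-z)$ does not act transitively on the nonzero solutions in $\mathbb{F}_p^3$ of $x^2+y^2+z^2-xyz=0$. $\mathbb{P}_{\mathrm{MP}}$ is the set of primes $p\ge5$ with $p\notin\mathbb{E}_{\mathrm{bgs}}$ such that either $p\equiv1\bmod4$, or the multiplicative order of $\frac{3+\sqrt5}{2}\in\mathbb{F}_{p^2}$ is at least $32\sqrt{p+1}$. For a finite group $G$, $\mathcal{M}(G)$ (over $\overline{\mathbb{Q}}$) is the stack finite étale over the moduli stack $\mathcal{M}(1)$ of elliptic curves whose fiber over an elliptic curve $E$ is the set of isomorphism classes of connected $G$-torsors over $E^\circ=E\setminus\{O\}$. Via monodromy this fiber is $\mathrm{Epi}(\Pi,G)/\mathrm{Inn}(G)$ with $\Pi=\pi_1^{\mathrm{top}}(E^\circ(\mathbb{C}))$ free on a basis $a,b$, and the monodromy action is given by the natural action of $\mathrm{Out}^+(\Pi)\cong\mathrm{SL}_2(\mathbb{Z})\cong\pi_1^{\mathrm{top}}(\mathcal{M}(1)^{\mathrm{an}})$ (outer automorphisms of determinant $1$ on $\Pi^{\mathrm{ab}}$).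 $\mathrm{Out}(G)$ acts on $\mathcal{M}(G)$. $\mathcal{M}(\mathrm{SL}_2(\mathbb{F}_p))_{-2}$ is the open and closed substack corresponding to $\varphi$ with $\mathrm{tr}\,\varphi([a,b])=-2$, and $\mathcal{M}(\mathrm{PSL}_2(\mathbb{F}_p))_{-2}$ is its image under the map $\mathcal{M}(\mathrm{SL}_2(\mathbb{F}_p))\to\mathcal{M}(\mathrm{PSL}_2(\mathbb{F}_p))$ induced by the quotient map. The superscript $\mathrm{abs}$ denotes the quotient by $D(p)=\mathrm{Out}(\mathrm{SL}_2(\mathbb{F}_p))$ (the image of conjugation by $\mathrm{GL}_2(\mathbb{F}_p)$), which also acts as $\mathrm{Out}(\mathrm{PSL}_2(\mathbb{F}_p))$. A finite étale map $\mathcal{M}\to\mathcal{M}(1)$ with $\mathcal{M}_{\mathbb{C}}$ connected corresponds to a finite index subgroup $\Gamma\le\mathrm{SL}_2(\mathbb{Z})$, unique up to conjugation (the stabilizer of a point of the fiber; $\mathcal{M}_{\mathbb{C}}^{\mathrm{an}}\cong[\mathcal{H}/\Gamma]$ with $\mathcal{H}$ the upper half plane). It is congruence if $\mathcal{M}_{\mathbb{C}}$ is connected and $\Gamma\supset\ker(\mathrm{SL}_2(\mathbb{Z})\to\mathrm{SL}_2(\mathbb{Z}/n))$ for some $n\ge1$, and noncongruence otherwise. *)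

(* Defs.v *)
From HB Require Import structures.
From mathcomp Require Import all_boot all_order all_algebra all_fingroup.
From mathcomp Require Import all_solvable all_field.
From mathcomp Require Import boolp classical_sets.

Set Implicit Arguments.
Unset Strict Implicit.
Unset Printing Implicit Defensive.

Import GRing.Theory Num.Theory.

Local Open Scope classical_set_scope.
Local Open Scope group_scope.

Section FreeGroup.
Variable T : choiceType.

(* The letter [(t, false)] stands for [t], and [(t, true)] for [t^-1]. *)
Definition letter := (T * bool)%type.
Definition linv (x : letter) : letter := (x.1, ~~ x.2).

Definition reduced (w : seq letter) := sorted (fun x y => y != linv x) w.

Record freeGroup := FreeGroup { fgword :> seq letter; fgwordP : reduced fgword }.

HB.instance Definition _ := [isSub for fgword].
HB.instance Definition _ := [Choice of freeGroup by <:].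

Definition push (x : letter) (w : seq letter) : seq letter :=
  if w is y :: w' then if y == linv x then w' else x :: w else [:: x].
Definition wmul (u v : seq letter) : seq letter := foldr push v u.
Definition winv (w : seq letter) : seq letter := rev (map linv w).

Lemma linvK : involutive linv.
Proof. by case=> t b; rewrite /linv /= negbK. Qed.

Lemma push_reduced x w : reduced w -> reduced (push x w).
Proof.
case: w => [//|y w] rw /=; case: ifP => [_|/negbT nyx]; first exact: path_sorted rw.
by rewrite /reduced /= nyx.
Qed.

Lemma pushK x w : reduced w -> push (linv x) (push x w) = w.
Proof.
case: w => [_|y w] /=; first by rewrite linvK eqxx.
case: ifP => [/eqP-> |_ _]; last by rewrite /= linvK eqxx.
by case: w => [//|z w] /= /andP[/negPf-> _].
Qed.

Lemma wmul_reduced u v : reduced v -> reduced (wmul u v).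
Proof. by move=> rv; elim: u => //= x u; apply: push_reduced. Qed.

Lemma wmul_push x v w : reduced v -> reduced w ->
  wmul (push x v) w = push x (wmul v w).
Proof.
case: v => [//|y v] rv rw /=; case: ifP => [/eqP-> |//].
by have := pushK (linv x) (wmul_reduced v rw); rewrite linvK => ->.
Qed.

Lemma wmulA u v w : reduced v -> reduced w ->
  wmul u (wmul v w) = wmul (wmul u v) w.
Proof.
by move=> rv rw; elim: u => //= x u ->; rewrite wmul_push // wmul_reduced.
Qed.

Lemma wmul1 u : reduced u -> wmul u [::] = u.
Proof.
elim: u => [//|x u IH] ru /=; rewrite IH; last exact: path_sorted ru.
by case: u ru {IH} => [//|y u] /= /andP[/negPf-> _].
Qed.

Lemma winv_reduced u : reduced u -> reduced (winv u).
Proof.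
rewrite /reduced /winv rev_sorted sorted_map; apply: sub_sorted => x y /=.
by apply: contra => /eqP /(can_inj linvK) ->; rewrite linvK.
Qed.

Lemma wmul_cat u v w : wmul (u ++ v) w = wmul u (wmul v w).
Proof. exact: foldr_cat. Qed.

Lemma wmulV u : reduced u -> wmul (winv u) u = [::].
Proof.
elim: u => [//|x u IH] ru; rewrite /winv map_cons rev_cons -cats1 wmul_cat /=.
by rewrite linvK eqxx IH //; apply: path_sorted ru.
Qed.

Lemma winvK : involutive winv.
Proof.
by move=> u; rewrite /winv map_rev revK -map_comp (eq_map linvK) map_id.
Qed.

Definition fgmul (u v : freeGroup) := FreeGroup (wmul_reduced u (fgwordP v)).
Definition fgone : freeGroup := @FreeGroup [::] isT.
Definition fginv (u : freeGroup) := FreeGroup (winv_reduced (fgwordP u)).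

Fact fgmulA : associative fgmul.
Proof. by move=> u v w; apply: val_inj; apply: wmulA; apply: fgwordP. Qed.
Fact fgmul1 : left_id fgone fgmul.
Proof. by move=> u; apply: val_inj. Qed.
Fact fgmulr1 : right_id fgone fgmul.
Proof. by move=> u; apply: val_inj; apply: wmul1; apply: fgwordP. Qed.
Fact fgmulV : left_inverse fgone fginv fgmul.
Proof. by move=> u; apply: val_inj; apply: wmulV; apply: fgwordP. Qed.
Fact fgmulrV : right_inverse fgone fginv fgmul.
Proof.
move=> u; rewrite -{1}[u](_ : fginv (fginv u) = u) ?fgmulV //.
by apply: val_inj; apply: winvK.
Qed.

HB.instance Definition _ :=
  isGroup.Build freeGroup fgmulA fgmul1 fgmulr1 fgmulV fgmulrV.

Definition fggen (t : T) : freeGroup := @FreeGroup [:: (t, false)] isT.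

(* The universal property: [fglift f] is the only homomorphism extending [f]. *)
Section Lift.
Variables (G : groupType) (f : T -> G).

Definition leval (x : letter) : G := if x.2 then (f x.1)^-1 else f x.1.
Definition weval (w : seq letter) : G := foldr (fun x g => leval x * g) 1 w.
Definition fglift (u : freeGroup) : G := weval u.

Lemma weval_push x w : weval (push x w) = leval x * weval w.
Proof.
case: w => [//|y w] /=; case: eqP => [-> |//] /=.
by rewrite /leval /=; case: x.2; rewrite mulgA ?mulVg ?mulgV mul1g.
Qed.

Lemma fgliftM : {morph fglift : u v / u * v}.
Proof.
move=> [u ru] v; rewrite /fglift /=; elim: u {ru} => [|x u IH] /=.
  by rewrite mul1g.
by rewrite weval_push IH mulgA.
Qed.

Lemma fglift_gen t : fglift (fggen t) = f t.
Proof. exact: mulg1. Qed.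

Lemma fglift_uniq (h : freeGroup -> G) :
  {morph h : u v / u * v} -> (forall t, h (fggen t) = f t) -> h =1 fglift.
Proof.
move=> hM hf.
have h1 : h 1 = 1 by apply: (mulgI (h 1)); rewrite -hM !mulg1.
move=> [u ru]; rewrite /fglift /=; elim: u ru => [|x u IH] ru /=.
  by rewrite -h1; congr h; apply: val_inj.
have ru' : reduced u by apply: path_sorted ru.
rewrite -(IH ru'); have rx : reduced [:: x] by [].
rewrite (_ : FreeGroup ru = FreeGroup rx * FreeGroup ru'); last first.
  by apply: val_inj => /=; case: (u) ru => [//|y v] /= /andP[/negPf-> _].
rewrite hM; congr (_ * _); case: x rx {ru} => t [] rx; rewrite /leval /= -hf.
  apply: (mulgI (h (fggen t))); rewrite mulgV -h1 -hM; congr h.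
  by apply: val_inj; rewrite /= eqxx.
by congr h; apply: val_inj.
Qed.

End Lift.
End FreeGroup.

Definition Pi := freeGroup 'I_2.
Definition gen (i : 'I_2) : Pi := fggen i.
Definition Pi_a : Pi := gen ord0.
Definition Pi_b : Pi := gen ord_max.

Definition is_hom (G H : groupType) (f : G -> H) := {morph f : u v / u * v}.

(* The image of [w] in Pi^ab = Z^2, in the basis given by the generators. *)
Definition expsum (w : Pi) (i : 'I_2) : int :=
  (\sum_(x <- fgword w | x.1 == i) (if x.2 then -1 else 1))%R.

Definition abmx (alpha : Pi -> Pi) : 'M[int]_2 :=
  (\matrix_(i, j) expsum (alpha (gen j)) i)%R.

Definition AutPlus : set (Pi -> Pi) :=
  [set alpha | [/\ is_hom alpha, bijective alpha & (\det (abmx alpha) = 1)%R]].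

(* [abmx] induces an isomorphism from AutPlus / Inn(Pi) to SL_2(Z); this is the
   preimage in AutPlus of the kernel of SL_2(Z) -> SL_2(Z/n). *)
Definition principal (n : nat) : set (Pi -> Pi) :=
  [set alpha | AutPlus alpha /\
     forall i j, (abmx alpha i j = (1%:M : 'M[int]_2)%R i j %[mod n])%Z].

(* A finite etale stack over M(1), through its fiber with monodromy.
   [mon alpha] describes the action of [alpha] on the right (by precomposition
   on homomorphisms out of Pi); orbits and stabilizers are unaffected by
   inverting it into a left action. *)
Record etale_cover := EtaleCover {
  cpoint : Type;
  cfiber : set cpoint;
  mon : (Pi -> Pi) -> cpoint -> cpoint
}.
Arguments cfiber : clear implicits.

Definition connected_cover (X : etale_cover) : Prop :=
  cfiber X !=set0 /\
  forall x y, cfiber X x -> cfiber X y ->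
    exists2 alpha, AutPlus alpha & mon alpha x = y.

(* The preimage in AutPlus of the subgroup Gamma of SL_2(Z). *)
Definition stabilizer (X : etale_cover) (x : cpoint X) : set (Pi -> Pi) :=
  [set alpha | AutPlus alpha /\ mon alpha x = x].

Definition congruence_cover (X : etale_cover) : Prop :=
  connected_cover X /\
  exists2 x, cfiber X x &
  exists2 n, (1 <= n)%N & principal n `<=` stabilizer x.

Definition noncongruence (X : etale_cover) : Prop := ~ congruence_cover X.

(* The open and closed substack supported on the points in [P]. *)
Definition subcover (X : etale_cover) (P : set (cpoint X)) : etale_cover :=
  EtaleCover (cfiber X `&` P) (@mon X).

(* The image of [X] under a map to [Y] given on fibers by [f]. *)
Definition image_cover (X Y : etale_cover) (f : cpoint X -> cpoint Y) :
  etale_cover :=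
  EtaleCover (f @` cfiber X) (@mon Y).

(* The quotient of [X] by [D] acting through [act]; points are D-orbits. *)
Definition quotient_cover (X : etale_cover) (D : Type)
    (act : D -> cpoint X -> cpoint X) : etale_cover :=
  EtaleCover [set [set act d x | d in setT] | x in cfiber X]
        (fun alpha (O : set (cpoint X)) => mon alpha @` O).

Section MG.
Variables (gT : finGroupType) (G : {group gT}).

Definition Epi : set (Pi -> gT) :=
  [set phi | is_hom phi /\ range phi = [set` G]].

Definition postcomp (rT : finGroupType) (f : gT -> rT) (C : set (Pi -> gT)) :
  set (Pi -> rT) := [set f \o phi | phi in C].

Definition conj_class (phi : Pi -> gT) : set (Pi -> gT) :=
  [set conjg^~ g \o phi | g in [set` G]].

Definition M_ : etale_cover :=
  EtaleCover [set conj_class phi | phi in Epi]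
        (fun alpha (C : set (Pi -> gT)) => [set phi \o alpha | phi in C]).

End MG.

Section SL2.
Variable p : nat.
Local Notation GL := {'GL_2['F_p]}.

Definition SL2_set : {set GL} := [set u : GL | (\det (GLval u) == 1)%R]%SET.

Fact SL2_group_set : group_set SL2_set.
Proof.
apply/group_setP; split=> [|u v]; rewrite !inE ?det1 // => /eqP du /eqP dv.
by rewrite GL_ME detM du dv mulr1.
Qed.

Definition SL2 : {group GL} := Group SL2_group_set.

Definition PSL2 : {group coset_of 'Z(SL2)} := (SL2 / 'Z(SL2))%G.

Definition trace_m2 : set (cpoint (M_ SL2)) :=
  [set C | forall phi, C phi ->
     (\tr (GLval (phi [~ Pi_a, Pi_b])) = - 2%:R)%R].

Definition M_SL2_m2 : etale_cover := @subcover (M_ SL2) trace_m2.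

Definition SL2_to_PSL2 : cpoint M_SL2_m2 -> cpoint (M_ PSL2) :=
  postcomp (coset 'Z(SL2)).

Definition M_PSL2_m2 : etale_cover := @image_cover M_SL2_m2 (M_ PSL2) SL2_to_PSL2.

(* The action of D(p), through conjugation by GL_2(F_p); on PSL_2(F_p) this is
   conjugation by classes modulo 'Z(SL2), which GL_2(F_p) normalizes. *)
Definition M_SL2_m2_abs : etale_cover :=
  @quotient_cover M_SL2_m2 GL (fun d => postcomp (conjg^~ d)).

Definition M_PSL2_m2_abs : etale_cover :=
  @quotient_cover M_PSL2_m2 GL (fun d => postcomp (conjg^~ (coset 'Z(SL2) d))).

End SL2.

Section Markoff.
Local Open Scope ring_scope.
Variable p : nat.
Local Notation V := 'rV['F_p]_3.
Local Notation i0 := (inord 0 : 'I_3).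
Local Notation i1 := (inord 1 : 'I_3).
Local Notation i2 := (inord 2 : 'I_3).

Definition markoff (v : V) : bool :=
  (v 0 i0 ^+ 2 + v 0 i1 ^+ 2 + v 0 i2 ^+ 2 - v 0 i0 * v 0 i1 * v 0 i2 == 0)
  && (v != 0).

Definition vieta (v : V) : V :=
  \row_j (if j == i2 then v 0 i0 * v 0 i1 - v 0 i2 else v 0 j).

Fact vietaK : involutive vieta.
Proof.
move=> v; apply/rowP => j; rewrite !mxE eqxx.
have [n02 n12] : (i0 != i2) /\ (i1 != i2) by rewrite -!val_eqE /= !inordK.
by rewrite (negPf n02) (negPf n12); case: eqP => [-> |//]; rewrite opprB addrC subrK.
Qed.

Fact coord_perm_inj (s : 'S_3) : injective (@col_perm 'F_p 1 3 s).
Proof.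
by apply: (can_inj (g := col_perm s^-1)) => v; rewrite -col_permM mulVg col_perm1.
Qed.

Definition markoff_group : {set {perm V}} :=
  <<perm (inv_inj vietaK) |: [set perm (@coord_perm_inj s) | s : 'S_3]%SET>>%g.

End Markoff.

Definition E_bgs (p : nat) : Prop :=
  prime p /\
  ~ (forall v w : 'rV['F_p]_3, markoff v -> markoff w ->
       exists2 g, g \in markoff_group p & g v = w).

(* The multiplicative order of (3 + sqrt 5) / 2 in F_(p^2) is at least [r].
   The two choices of sqrt 5 give inverse elements. *)
Definition order_ge (p : nat) (r : algC) : Prop :=
  exists (L : finFieldType) (s : L) (u : {unit L}),
    [/\ #|L| = (p ^ 2)%N, (s ^+ 2 = 5%:R)%R,
        (val u = (3%:R + s) / 2%:R)%R & (r <= #[u]%:R)%R].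

Definition P_MP (p : nat) : Prop :=
  [/\ prime p, (5 <= p)%N, ~ E_bgs p
    & p = 1 %[mod 4] \/ order_ge p (32%:R * sqrtC (p.+1)%:R)%R].

(* Main.v *)
Require Import Defs.
From HB Require Import structures.
From mathcomp Require Import all_boot all_order all_algebra all_fingroup.
From mathcomp Require Import all_solvable all_field.
From mathcomp Require Import boolp classical_sets.
From mathcomp Require Import ring zify.

(**
Suppose that the action of SL_2(Z) on the fiber is transitive and factors
through SL_2(Z/n).  Let l be a prime.  If some point is fixed by the r-th powers
of both standard Dehn twists, with r prime to l, then the l-primary factor of
SL_2(Z/n) fixes that point; being normal, it acts trivially, so that all orbits
of a Dehn twist have length prime to l.  This is contradicted by exhibiting
surjections onto SL_2(F_p) with trace -2 through solutions (x, y, z) of the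
Markoff equation.  A point with first trace x <> 0 is fixed by a power of a
Dehn twist exactly when that power of the matrix of trace x is plus or minus 1.
If p = 1 mod 4, take l = p, with (0, 1, i) as the fixed point (r = 6) and
(2, 0, 2i) as the point with an orbit of length divisible by p.
If p = 3 mod 4, take l = 2: when x and y are both of the form w + 1/w with w in
F_p, r = (p - 1) / 2 is odd and works, and a solution with such x and y exists by
counting; when 2 + x and 2 - x are both nonsquares, no odd power of a matrix of
trace x is plus or minus 1.
*)

Set Implicit Arguments.
Unset Strict Implicit.
Unset Printing Implicit Defensive.

Import GRing.Theory Num.Theory.

Local Open Scope classical_set_scope.
Local Open Scope group_scope.

(** * Homomorphisms out of a free group *)

Lemma freeGroup_elim (T : choiceType) (P : freeGroup T -> Prop) : P 1 ->
  (forall t w, P w -> P (fggen t * w)) ->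
  (forall t w, P w -> P ((fggen t)^-1 * w)) -> forall w, P w.
Proof.
move=> P1 Pg Pv [w rw]; elim: w rw => [|[t b] w IH] rw.
  by rewrite (_ : FreeGroup rw = 1) //; apply: val_inj.
have rw' : reduced w by apply: path_sorted rw.
(* The word is reduced, so putting its first letter back cancels nothing. *)
have /= ne : push (t, b) w = (t, b) :: w.
  by case: w rw {IH rw'} => [//|y v] /= /andP[/negPf-> _].
case: b rw ne => rw ne.
  rewrite (_ : FreeGroup rw = (fggen t)^-1 * FreeGroup rw'); last exact: val_inj.
  exact/Pv/IH.
rewrite (_ : FreeGroup rw = fggen t * FreeGroup rw'); last exact: val_inj.
exact/Pg/IH.
Qed.

Lemma is_hom1 (G H : groupType) (f : G -> H) : is_hom f -> f 1 = 1.
Proof. by move=> fM; apply: (mulgI (f 1)); rewrite -fM !mulg1. Qed.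

Lemma is_homV (G H : groupType) (f : G -> H) : is_hom f -> {morph f : u / u^-1}.
Proof. by move=> fM u; apply: (mulgI (f u)); rewrite -fM !mulgV is_hom1. Qed.

Lemma is_homX (G H : groupType) (f : G -> H) : is_hom f ->
  forall n, {morph f : u / u ^+ n}.
Proof.
by move=> fM n u; elim: n => [|n IH]; rewrite ?expg0 ?is_hom1 // !expgS fM IH.
Qed.

Lemma is_hom_comp (G H K : groupType) (f : H -> K) (g : G -> H) :
  is_hom f -> is_hom g -> is_hom (f \o g).
Proof. by move=> fM gM u v /=; rewrite gM fM. Qed.

Lemma I2_cases (t : 'I_2) : t = ord0 \/ t = ord_max.
Proof. by case: t => [[|[|//]] lt]; [left|right]; apply: val_inj. Qed.

Lemma Pi_hom_eq (G : groupType) (f g : Pi -> G) : is_hom f -> is_hom g ->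
  f Pi_a = g Pi_a -> f Pi_b = g Pi_b -> f = g.
Proof.
move=> fM gM ea eb; apply/funext => w.
have e t : f (gen t) = g (gen t).
  by case: (I2_cases t) => ->.
rewrite (fglift_uniq (f := fun t => g (gen t)) fM e w).
by rewrite -(fglift_uniq (f := fun t => g (gen t)) gM _ w).
Qed.

Definition pair_hom (G : groupType) (u v : G) : Pi -> G :=
  fglift (fun i : 'I_2 => if i == ord0 then u else v).

Section PairHom.
Variables (G : groupType) (u v : G).

Lemma pair_homM : is_hom (pair_hom u v).
Proof. exact: fgliftM. Qed.

Lemma pair_hom_a : pair_hom u v Pi_a = u.
Proof. by rewrite /pair_hom fglift_gen. Qed.

Lemma pair_hom_b : pair_hom u v Pi_b = v.
Proof. by rewrite /pair_hom fglift_gen. Qed.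

End PairHom.

(** * Abelianization and the action of automorphisms on it *)

Section ExponentSum.
Local Open Scope ring_scope.

(** Two letters cancelled by [push] contribute 1 and -1, so a push changes the exponent sum by that
    of the pushed letter whether or not it cancels. *)
Lemma expsumM (u v : Pi) i : expsum (u * v)%g i = expsum u i + expsum v i.
Proof.
pose s (w : seq (letter 'I_2)) : int :=
  \sum_(x <- w | x.1 == i) (if x.2 then -1 else 1).
have sp x w : s (push x w) = s [:: x] + s w.
  case: w => [|y w] /=; first by rewrite /s big_nil addr0.
  case: eqP => [->|_]; rewrite /s !big_cons !big_nil /=; last first.
    by case: ifP => _; rewrite ?addr0 ?add0r.
  by case: ifP => _; rewrite ?addr0 ?add0r //; case: x.2 => /=; lia.
rewrite -[expsum _ _]/(s (wmul u v)) -[expsum u i]/(s u) -[expsum v i]/(s v).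
elim: (fgword u) => [|x w IH] /=; first by rewrite {2}/s big_nil add0r.
by rewrite sp IH addrA; congr (_ + _); rewrite /s !big_cons big_nil; case: ifP;
  rewrite ?addr0 ?add0r.
Qed.

Lemma expsum1 i : expsum (1%g : Pi) i = 0.
Proof. by apply: (addrI (expsum 1%g i)); rewrite -expsumM mulg1 addr0. Qed.

Lemma expsumV (u : Pi) i : expsum u^-1%g i = - expsum u i.
Proof. by apply: (addrI (expsum u i)); rewrite -expsumM mulgV expsum1 subrr. Qed.

Lemma expsumX (u : Pi) n i : expsum (u ^+ n)%g i = expsum u i *+ n.
Proof. by elim: n => [|n IH]; rewrite ?expg0 ?expsum1 // expgS expsumM IH mulrS. Qed.

Lemma expsum_gen i j : expsum (gen j) i = (i == j)%:R.
Proof. by rewrite /expsum big_cons big_nil /= eq_sym; case: eqP. Qed.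

Lemma expsum_hom (alpha : Pi -> Pi) (w : Pi) i : is_hom alpha ->
  expsum (alpha w) i = \sum_j expsum (alpha (gen j)) i * expsum w j.
Proof.
move=> aM; elim/freeGroup_elim: w => [|t w IH|t w IH].
- by rewrite is_hom1 // expsum1 big1 // => j _; rewrite expsum1 mulr0.
- rewrite aM expsumM IH (eq_bigr _ (fun j _ => congr2 _ erefl (expsumM _ _ _))).
  rewrite (eq_bigr _ (fun j _ => mulrDr _ _ _)) big_split /=; congr (_ + _).
  rewrite (bigD1 t) //= expsum_gen eqxx mulr1 big1 ?addr0 // => j /negPf jt.
  by rewrite expsum_gen jt mulr0.
- rewrite aM expsumM IH (eq_bigr _ (fun j _ => congr2 _ erefl (expsumM _ _ _))).
  rewrite (eq_bigr _ (fun j _ => mulrDr _ _ _)) big_split /=; congr (_ + _).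
  rewrite is_homV // expsumV (bigD1 t) //= expsumV expsum_gen eqxx mulrN1.
  rewrite big1 ?addr0 // => j /negPf jt.
  by rewrite expsumV expsum_gen jt oppr0 mulr0.
Qed.

Lemma abmxM (alpha beta : Pi -> Pi) : is_hom alpha ->
  abmx (alpha \o beta) = abmx alpha *m abmx beta.
Proof.
move=> aM; apply/matrixP=> i j; rewrite !mxE /= (expsum_hom _ _ aM).
by apply: eq_bigr => k _; rewrite !mxE.
Qed.

Lemma abmx_id : abmx id = 1%:M.
Proof. by apply/matrixP=> i j; rewrite !mxE expsum_gen. Qed.

End ExponentSum.

Lemma AutPlus_comp alpha beta :
  AutPlus alpha -> AutPlus beta -> AutPlus (alpha \o beta).
Proof.
move=> [aM ab ad] [bM bb bd]; split; first exact: is_hom_comp.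
  exact: bij_comp.
by rewrite abmxM // det_mulmx ad bd mulr1.
Qed.

Lemma AutPlus_inv alpha : AutPlus alpha ->
  exists beta, [/\ AutPlus beta, alpha \o beta = id & beta \o alpha = id].
Proof.
move=> [aM [beta ba ab] ad]; exists beta.
have bM : is_hom beta.
  by move=> u v; apply: (can_inj ba); rewrite aM !ab.
have eab : alpha \o beta = id by apply/funext=> w; apply: ab.
split=> //; last by apply/funext=> w; apply: ba.
split=> //; first by exists alpha.
by have := congr1 determinant (abmxM beta aM);
  rewrite eab abmx_id det1 det_mulmx ad mul1r.
Qed.

(** * Dehn twists and their elementary matrices *)

(** These are the [k]-th powers of the Dehn twists along the two generators. Natural exponents
    suffice, since every residue modulo [N] has a natural representative. *)
Definition twist_a (k : nat) : Pi -> Pi := pair_hom Pi_a (Pi_a ^+ k * Pi_b).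
Definition twist_b (k : nat) : Pi -> Pi := pair_hom (Pi_b ^+ k * Pi_a) Pi_b.

Section Mx2.
Local Open Scope ring_scope.

Definition mx2 (R : Type) (a b c d : R) : 'M[R]_2 :=
  \matrix_(i, j) if i == ord0 then if j == ord0 then a else b
                 else if j == ord0 then c else d.

Lemma mx2P (R : Type) (A B : 'M[R]_2) :
  A ord0 ord0 = B ord0 ord0 -> A ord0 ord_max = B ord0 ord_max ->
  A ord_max ord0 = B ord_max ord0 -> A ord_max ord_max = B ord_max ord_max ->
  A = B.
Proof.
move=> e00 e01 e10 e11; apply/matrixP=> i j.
by case: (I2_cases i) => ->; case: (I2_cases j) => ->.
Qed.

Lemma mx2E (R : Type) (A : 'M[R]_2) :
  A = mx2 (A ord0 ord0) (A ord0 ord_max) (A ord_max ord0) (A ord_max ord_max).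
Proof. by apply: mx2P; rewrite !mxE. Qed.

Lemma mul_mx2 (R : nzRingType) (a b c d a' b' c' d' : R) :
  mx2 a b c d *m mx2 a' b' c' d' =
  mx2 (a * a' + b * c') (a * b' + b * d') (c * a' + d * c') (c * b' + d * d').
Proof. by apply: mx2P; rewrite !mxE !big_ord_recl big_ord0 !mxE /= addr0. Qed.

Lemma det_mx2 (R : comNzRingType) (a b c d : R) :
  \det (mx2 a b c d) = a * d - b * c.
Proof.
rewrite (expand_det_row _ ord0) !big_ord_recl big_ord0 /cofactor !det_mx11.
by rewrite !mxE /= expr0 expr1 mul1r mulN1r mulrN addr0.
Qed.

Lemma tr_mx2 (R : nzRingType) (a b c d : R) : \tr (mx2 a b c d) = a + d.
Proof. by rewrite /mxtrace !big_ord_recl big_ord0 !mxE /= addr0. Qed.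

Lemma mx2_1 (R : nzRingType) : 1%:M = mx2 1 0 0 1 :> 'M[R]_2.
Proof. by apply: mx2P; rewrite !mxE. Qed.

Lemma map_mx2 (R S : Type) (f : R -> S) (a b c d : R) :
  map_mx f (mx2 a b c d) = mx2 (f a) (f b) (f c) (f d).
Proof. by apply: mx2P; rewrite !mxE. Qed.

Lemma abmx_twist_a k : abmx (twist_a k) = mx2 1 k%:R 0 1.
Proof.
by apply: mx2P; rewrite !mxE /twist_a ?pair_hom_a ?pair_hom_b ?expsumM ?expsumX
  ?expsum_gen //= ?mul0rn ?add0r ?addr0.
Qed.

Lemma abmx_twist_b k : abmx (twist_b k) = mx2 1 0 k%:R 1.
Proof.
by apply: mx2P; rewrite !mxE /twist_b ?pair_hom_a ?pair_hom_b ?expsumM ?expsumX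
  ?expsum_gen //= ?mul0rn ?add0r ?addr0.
Qed.

End Mx2.

Lemma pair_hom_bij (u v u' v' : Pi) :
  pair_hom u v u' = Pi_a -> pair_hom u v v' = Pi_b ->
  pair_hom u' v' u = Pi_a -> pair_hom u' v' v = Pi_b ->
  bijective (pair_hom u v).
Proof.
have can (x y x' y' : Pi) : pair_hom x y x' = Pi_a -> pair_hom x y y' = Pi_b ->
    cancel (pair_hom x' y') (pair_hom x y).
  move=> ea eb w; suff e : pair_hom x y \o pair_hom x' y' = id.
    exact: (congr1 (@^~ w) e).
  apply: Pi_hom_eq => //; first exact/is_hom_comp/pair_homM/pair_homM.
    by rewrite /= pair_hom_a.
  by rewrite /= pair_hom_b.
by move=> ea eb ea' eb'; exists (pair_hom u' v'); apply: can.
Qed.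

Lemma twist_a_Aut k : AutPlus (twist_a k).
Proof.
split; first exact: pair_homM.
  apply: (pair_hom_bij (u' := Pi_a) (v' := Pi_a ^- k * Pi_b)).
  - by rewrite pair_hom_a.
  - by rewrite pair_homM (is_homV (@pair_homM _ _ _)) (is_homX (@pair_homM _ _ _))
      pair_hom_a pair_hom_b mulKg.
  - by rewrite pair_hom_a.
  - by rewrite pair_homM (is_homX (@pair_homM _ _ _)) pair_hom_a pair_hom_b mulVKg.
by rewrite abmx_twist_a det_mx2 mulr0 mulr1 subr0.
Qed.

Lemma twist_b_Aut k : AutPlus (twist_b k).
Proof.
split; first exact: pair_homM.
  apply: (pair_hom_bij (u' := Pi_b ^- k * Pi_a) (v' := Pi_b)).
  - by rewrite pair_homM (is_homV (@pair_homM _ _ _)) (is_homX (@pair_homM _ _ _))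
      pair_hom_a pair_hom_b mulKg.
  - by rewrite pair_hom_b.
  - by rewrite pair_homM (is_homX (@pair_homM _ _ _)) pair_hom_a pair_hom_b mulVKg.
  - by rewrite pair_hom_b.
by rewrite abmx_twist_b det_mx2 mul0r mulr1 subr0.
Qed.

(** * Principal congruence subgroups through matrices over Z/n *)

Section Residues.
Local Open Scope ring_scope.

Lemma intr_Zp_eq0 n (z : int) : (1 < n)%N ->
  (z%:~R == 0 :> 'Z_n) = (n %| z)%Z.
Proof.
move=> n1; have natE (m : nat) : (m%:R == 0 :> 'Z_n) = (n %| m)%N.
  by rewrite -val_eqE /= val_Zp_nat.
case: z => m; first by rewrite -pmulrn natE.
by rewrite NegzE mulrNz oppr_eq0 -pmulrn natE dvdzE abszN.
Qed.

Lemma intr_Zp_mod n (x y : int) : (1 < n)%N ->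
  (x%:~R == y%:~R :> 'Z_n) = (x == y %[mod n])%Z.
Proof. by move=> n1; rewrite eqz_mod_dvd -intr_Zp_eq0 // intrB subr_eq0. Qed.

Definition mxZ n : 'M[int]_2 -> 'M['Z_n]_2 := map_mx intr.

(** The bound on [n] is there because ['Z_n] is Z/n only for [n > 1]; for smaller [n] it is Z/2. *)
Lemma principalP n alpha : (1 < n)%N ->
  principal n alpha <-> AutPlus alpha /\ mxZ n (abmx alpha) = 1%:M.
Proof.
move=> n1; split=> -[aP e]; split=> //.
  apply/matrixP=> i j; rewrite mxE.
  have /eqP := e i j; rewrite -intr_Zp_mod // => /eqP->.
  by rewrite !mxE; case: eqP.
move=> i j; apply/eqP; rewrite -intr_Zp_mod //.
have := congr1 (fun M : 'M_2 => M i j) e; rewrite mxE => ->.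
by rewrite !mxE; case: (i == j).
Qed.

End Residues.

(** * Conjugates of a transvection over a ring with an idempotent *)

Section Transvections.
Local Open Scope ring_scope.
Variables (R : comNzRingType) (a b c d e : R).
Hypotheses (det1 : a * d - b * c = 1) (ee : e * e = e).

(** The conjugate of a transvection by a matrix with first column (a, c) is 1 plus [e] times the
    column (a, c) times the row (-c, a). The conjugating matrix is kept on the right so that no
    inverse has to be written. *)
Lemma mul_transvection :
  mx2 a b c d *m mx2 1 e 0 1 =
  mx2 (1 - e * (a * c)) (e * (a * a)) (- (e * (c * c))) (1 + e * (a * c))
    *m mx2 a b c d.
Proof.
rewrite !mul_mx2; congr mx2.
- ring.
- have -> : a * e + b * 1 = a * e * (a * d - b * c) + b by rewrite det1; ring.
  ring.
- ring.
- have -> : c * e + d * 1 = c * e * (a * d - b * c) + d by rewrite det1; ring.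
  ring.
Qed.

(** On the component of the ring cut out by [e], [c] is invertible with inverse [c']. The upper
    transvection by a/c carries (0, c) to (a, c), so it conjugates a lower transvection to the one
    with direction (a, c). *)
Lemma conj_transvection_lower c' : e * (c * c') = e ->
  mx2 a b c d *m mx2 1 e 0 1 =
  mx2 1 (e * (a * c')) 0 1 *m mx2 1 0 (e * - (c * c)) 1 *m
    mx2 1 (e * - (a * c')) 0 1 *m mx2 a b c d.
Proof.
move=> ec; rewrite mul_transvection; congr (_ *m _).
have u1 : e * (a * c') * (e * (c * c)) = e * (a * c).
  have -> : e * (a * c') * (e * (c * c)) = (e * e) * (c * c') * (a * c) by ring.
  by rewrite ee ec.
have u2 : e * (a * c) * (e * (a * c')) = e * (a * a).
  have -> : e * (a * c) * (e * (a * c')) = (e * e) * (c * c') * (a * a) by ring.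
  by rewrite ee ec.
rewrite !mul_mx2; congr mx2.
- rewrite -u1; ring.
- by rewrite -u2 -u1; ring.
- ring.
- rewrite -u1; ring.
Qed.

(** If instead [a] is invertible on that component, the lower transvection by c/a carries (a, 0) to
    (a, c). *)
Lemma conj_transvection_upper a' : e * (a * a') = e ->
  mx2 a b c d *m mx2 1 e 0 1 =
  mx2 1 0 (e * (c * a')) 1 *m mx2 1 (e * (a * a)) 0 1 *m
    mx2 1 0 (e * - (c * a')) 1 *m mx2 a b c d.
Proof.
move=> ea; rewrite mul_transvection; congr (_ *m _).
have u1 : e * (c * a') * (e * (a * a)) = e * (a * c).
  have -> : e * (c * a') * (e * (a * a)) = (e * e) * (a * a') * (a * c) by ring.
  by rewrite ee ea.
have u2 : e * (a * c) * (e * (c * a')) = e * (c * c).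
  have -> : e * (a * c) * (e * (c * a')) = (e * e) * (a * a') * (c * c) by ring.
  by rewrite ee ea.
rewrite !mul_mx2; congr mx2.
- rewrite -u1; ring.
- ring.
- by rewrite -u2 -u1; ring.
- rewrite -u1; ring.
Qed.
End Transvections.

(** * Consequences of congruence for a cover *)

Section Cover.
Local Open Scope ring_scope.
Variable X : etale_cover.
Hypothesis monM : forall alpha beta (x : cpoint X),
  mon (alpha \o beta) x = mon beta (mon alpha x).

Lemma mxZM n alpha beta : is_hom alpha ->
  mxZ n (abmx (alpha \o beta)) = mxZ n (abmx alpha) *m mxZ n (abmx beta).
Proof. by move=> aM; rewrite abmxM // /mxZ map_mxM. Qed.

Lemma mxZM3 n alpha beta gamma : is_hom alpha -> is_hom beta ->
  mxZ n (abmx (alpha \o (beta \o gamma))) =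
  mxZ n (abmx alpha) *m mxZ n (abmx beta) *m mxZ n (abmx gamma).
Proof. by move=> aM bM; rewrite (mxZM _ _ aM) (mxZM _ _ bM) mulmxA. Qed.

(** Principal subgroups are normal: [gamma alpha beta^-1 gamma^-1] is trivial modulo [n], hence
    fixes [x]. So the action on each point of the orbit of [x] depends only on matrices modulo
    [n]. *)
Lemma mon_congr n (x : cpoint X) alpha beta gamma : (1 < n)%N ->
  principal n `<=` stabilizer x ->
  AutPlus alpha -> AutPlus beta -> AutPlus gamma ->
  mxZ n (abmx alpha) = mxZ n (abmx beta) ->
  mon alpha (mon gamma x) = mon beta (mon gamma x).
Proof.
move=> n1 sub Ha Hb Hg eab.
have [gi [Hgi ggi gig]] := AutPlus_inv Hg.
have [bi [Hbi bbi bib]] := AutPlus_inv Hb.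
have [[aM _ _] [bM _ _] [gM _ _]] := And3 Ha Hb Hg.
pose delta := gamma \o (alpha \o (bi \o gi)).
have Hd : AutPlus delta by do 3!apply: AutPlus_comp => //.
have dP : principal n delta.
  apply/principalP => //; split=> //.
  rewrite /delta (mxZM _ _ gM) (mxZM _ _ aM) eab -(mxZM _ _ bM) -(mxZM _ _ gM).
  have -> : gamma \o (beta \o (bi \o gi)) = id.
    apply/funext=> w /=.
    have /= -> := congr1 (@^~ (gi w)) bbi.
    exact: (congr1 (@^~ w) ggi).
  by rewrite abmx_id /mxZ map_mx1.
have [_ dx] := sub _ dP.
rewrite -!monM -[in RHS](dx) -monM; congr (mon _ x).
apply/funext=> w; rewrite /delta /=.
have /= -> := congr1 (@^~ (beta w)) gig.
by have /= -> := congr1 (@^~ w) bib.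
Qed.

Lemma mxZ_twist_a n k : mxZ n (abmx (twist_a k)) = mx2 1 k%:R 0 1.
Proof. by rewrite abmx_twist_a /mxZ map_mx2 rmorph1 rmorph0 rmorph_nat. Qed.

Lemma mxZ_twist_b n k : mxZ n (abmx (twist_b k)) = mx2 1 0 k%:R 1.
Proof. by rewrite abmx_twist_b /mxZ map_mx2 rmorph1 rmorph0 rmorph_nat. Qed.

(** By the Chinese remainder theorem, take [e] equal to 1 modulo the [l]-part and to 0 modulo the
    rest. It projects Z/n onto its [l]-primary factor, where integers prime to [l] become units. *)
Lemma idempotent_residue (n l : nat) : (0 < n)%N -> prime l -> (l %| n)%N ->
  exists e : nat, [/\ ~~ (l %| e)%N, (n`_l^' %| e)%N,
    e%:R * e%:R = e%:R :> 'Z_n &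
    forall c : int, ~~ (l %| c)%Z ->
      exists c' : int, e%:R * (c%:~R * c'%:~R) = e%:R :> 'Z_n].
Proof.
move=> n0 lp ln.
have n1 : (1 < n)%N by apply: leq_trans (prime_gt1 lp) (dvdn_leq n0 ln).
pose q := (n`_l)%N; pose q' := (n`_l^')%N.
have cop : coprime q q' by apply: coprime_partC.
pose e := chinese q q' 1 0.
have el : e = 1 %[mod q] by apply: chinese_modl.
have el' : (q' %| e)%N by rewrite /dvdn chinese_modr // mod0n.
have e1 : (q %| e%:Z - 1)%Z.
  by rewrite -eqz_mod_dvd -[1%R]/(Posz 1) !modz_nat el.
have ll : (l %| q)%N.
  by rewrite /q p_part -{1}[l]expn1 dvdn_exp2l // logn_gt0 mem_primes lp n0.
(* [n] is [q * q'] and [q'] divides [e], so [e] kills the multiples of [q]. *)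
have mulP (z : int) : (q %| z)%Z -> (e%:R * z%:~R = 0 :> 'Z_n).
  move=> zl; apply/eqP; rewrite pmulrn -intrM intr_Zp_eq0 //.
  rewrite -(partnC l n0) mulrC PoszM dvdz_mul //.
exists e; split=> //.
- apply/negP=> le; have : (l %| 1%:Z)%Z.
    have -> : 1 = e%:Z - (e%:Z - 1) :> int by lia.
    by rewrite rpredB //; apply: dvdz_trans e1.
  by rewrite dvdzE /= Euclid_dvd1.
- by have := mulP (e%:Z - 1) e1; rewrite intrB mulrBr mulr1 -pmulrn => /subr0_eq.
- move=> c lc; have : coprimez c q.
    rewrite coprimezE /= coprime_sym /q p_part coprimeXl // prime_coprime //.
  move/coprimezP=> [[u v] /= uv]; exists u.
  have := mulP (c * u - 1); rewrite intrB mulrBr mulr1 intrM => h.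
  apply/subr0_eq/h.
  rewrite -[X in _ - X]uv mulrC opprD addrA subrr add0r -mulNr; exact: dvdz_mull.
Qed.

(* With [e] congruent to 1 modulo the [l]-part of [n] and divisible by the
   [l']-part, a conjugate of [twist_a e] agrees modulo [n] with a product of
   powers of [twist_a e] and [twist_b e], all of which fix [P]. *)
Lemma fixed_orbit (l r : nat) (x P Q : cpoint X) n :
  prime l -> (0 < r)%N -> ~~ (l %| r)%N -> (0 < n)%N ->
  connected_cover X -> cfiber X x -> principal n `<=` stabilizer x ->
  cfiber X P -> (forall k, (r %| k)%N -> mon (twist_a k) P = P) ->
  (forall k, (r %| k)%N -> mon (twist_b k) P = P) ->
  cfiber X Q -> exists2 e : nat, ~~ (l %| e)%N & mon (twist_a e) Q = Q.
Proof.
move=> lp r0 lr n0 [_ trans] xX sub PX Pa Pb QX.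
(* Passing to this multiple of [n] makes [l] divide the level and makes [r], being prime to [l],
   divide its prime-to-[l] part, hence [e]. *)
pose N := (n * (l * r))%N.
have N0 : (0 < N)%N by rewrite !muln_gt0 n0 r0 prime_gt0.
have lN : (l %| N)%N by rewrite dvdn_mull // dvdn_mulr.
have N1 : (1 < N)%N by apply: leq_trans (prime_gt1 lp) (dvdn_leq N0 lN).
have subN : principal N `<=` stabilizer x.
  move=> alpha [Ha aN]; apply: sub; split=> // i j; have /eqP := aN i j.
  rewrite !eqz_mod_dvd => d; apply/eqP; rewrite eqz_mod_dvd.
  by apply: dvdz_trans d; rewrite dvdzE /= dvdn_mulr.
have [e [le e' ee inv]] := idempotent_residue N0 lp lN.
have re : (r %| e)%N.
  apply: dvdn_trans e'; rewrite -(part_pnat_id (pi := l^') (n := r)).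
    by rewrite partn_dvd // !dvdn_mull.
  by rewrite p'natE.
exists e => //.
have [g0 Hg0 Px] := trans _ _ xX PX; have [g Hg PQ] := trans _ _ PX QX.
(* Since [g] carries [P] to [Q] and the action is on the right, [delta] fixing [P] makes [g]
   followed through [twist_a e] end at [Q] again. *)
suff [delta [Hd dP eq_d]] : exists delta, [/\ AutPlus delta, mon delta P = P &
    mxZ N (abmx (g \o twist_a e)) = mxZ N (abmx (delta \o g))].
  rewrite -PQ -monM -{1}Px.
  have -> := mon_congr N1 subN (AutPlus_comp Hg (twist_a_Aut e))
    (AutPlus_comp Hd Hg) Hg0 eq_d.
  by rewrite Px monM dP.
have [gM _ det_g] := Hg.
have aM k : is_hom (twist_a k) := @pair_homM _ _ _.
have bM k : is_hom (twist_b k) := @pair_homM _ _ _.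
(* A natural exponent representing [e * z] modulo [N]; the factor [e] makes it a multiple of [r], so
   the twists by it fix [P]. *)
pose f (z : 'Z_N) := (e * z)%N.
have fr z : (r %| f z)%N by rewrite dvdn_mulr.
have fE z : (f z)%:R = e%:R * z :> 'Z_N by rewrite natrM natr_Zp.
have := mx2E (abmx g); move: det_g; rewrite [in \det _](mx2E (abmx g)) det_mx2.
set a := abmx g ord0 ord0; set b := abmx g ord0 ord_max.
set c := abmx g ord_max ord0; set d := abmx g ord_max ord_max => det_g eq_g.
have det_gZ : a%:~R * d%:~R - b%:~R * c%:~R = 1 :> 'Z_N.
  by rewrite -!intrM -intrB det_g.
have eq_gZ : mxZ N (abmx g) = mx2 a%:~R b%:~R c%:~R d%:~R.
  by rewrite eq_g /mxZ map_mx2.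
(* As the determinant is 1, [l] does not divide both entries of the first column, so one of them is
   a unit on the [l]-primary factor. *)
have [lc|lc] := boolP (l %| c)%Z.
  have la : ~~ (l %| a)%Z.
    apply/negP=> la; have : (l %| 1%:Z)%Z.
      by rewrite -[Posz 1]/(1 : int) -det_g rpredB //; [rewrite mulrC; exact: dvdz_mull | exact: dvdz_mull].
    by rewrite dvdzE /= Euclid_dvd1.
  have [a' aa'] := inv _ la; move: (a'%:~R) aa' => {}a' aa'.
  exists (twist_b (f (c%:~R * a')) \o (twist_a (f (a%:~R * a%:~R)) \o
          twist_b (f (- (c%:~R * a'))))); split.
  - exact: (AutPlus_comp (twist_b_Aut _) (AutPlus_comp (twist_a_Aut _) (twist_b_Aut _))).
  - by rewrite !monM Pb // Pa // Pb.
  - rewrite (mxZM _ _ gM).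
  rewrite (mxZM _ _ (is_hom_comp (bM _) (is_hom_comp (aM _) (bM _)))).
    rewrite (mxZM3 _ _ (bM _) (aM _)) !mxZ_twist_a !mxZ_twist_b !fE.
    by rewrite eq_gZ (conj_transvection_upper det_gZ ee aa').
have [c' cc'] := inv _ lc; move: (c'%:~R) cc' => {}c' cc'.
exists (twist_a (f (a%:~R * c')) \o (twist_b (f (- (c%:~R * c%:~R))) \o
        twist_a (f (- (a%:~R * c'))))); split.
- exact: (AutPlus_comp (twist_a_Aut _) (AutPlus_comp (twist_b_Aut _) (twist_a_Aut _))).
- by rewrite !monM Pa // Pb // Pa.
- rewrite (mxZM _ _ gM).
  rewrite (mxZM _ _ (is_hom_comp (aM _) (is_hom_comp (bM _) (aM _)))).
  rewrite (mxZM3 _ _ (aM _) (bM _)) !mxZ_twist_a !mxZ_twist_b !fE.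
  by rewrite eq_gZ (conj_transvection_lower det_gZ ee cc').
Qed.

End Cover.

(** * Generators and center of SL_2 over a finite field *)

Section Mx2Field.
Local Open Scope ring_scope.
Variable K : fieldType.

Lemma mul_upper (s t : K) : mx2 1 s 0 1 *m mx2 1 t 0 1 = mx2 1 (s + t) 0 1.
Proof. by rewrite mul_mx2; congr mx2; ring. Qed.

Lemma mul_lower (s t : K) : mx2 1 0 s 1 *m mx2 1 0 t 1 = mx2 1 0 (s + t) 1.
Proof. by rewrite mul_mx2; congr mx2; ring. Qed.

Lemma det_upper (t : K) : \det (mx2 1 t 0 1) = 1.
Proof. by rewrite det_mx2; ring. Qed.

Lemma det_lower (t : K) : \det (mx2 1 0 t 1) = 1.
Proof. by rewrite det_mx2; ring. Qed.

Lemma mx2_transvections (a b c d : K) : c != 0 -> a * d - b * c = 1 ->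
  mx2 a b c d = mx2 1 ((a - 1) / c) 0 1 *m mx2 1 0 c 1 *m mx2 1 ((d - 1) / c) 0 1.
Proof.
move=> c0 det1; have -> : b = (a * d - 1) / c by rewrite -det1; field.
by rewrite !mul_mx2; congr mx2; field.
Qed.

End Mx2Field.

Section SL2Matrices.
Local Open Scope ring_scope.
Variable F : finFieldType.
Local Notation GL := {'GL_2[F]}.
Variable S : {group GL}.
Hypothesis in_S : forall u : GL, (u \in S) = (\det (GLval u) == 1).
Implicit Types (u v : GL) (M : 'M[F]_2).

(** A singular matrix is sent to the identity; [glmxK] shows that this default is not met in
    determinant 1. *)
Definition glmx M : GL := insubd (1%g : GL) M.

Lemma glmxK M : \det M = 1 -> GLval (glmx M) = M.
Proof. by move=> dM; apply: insubdK; rewrite -topredE /= unitmxE dM unitr1. Qed.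

Lemma GLval_inj : injective (@GLval 2 F).
Proof. exact: val_inj. Qed.

Lemma GLM u v : GLval (u * v)%g = (GLval u : 'M[F]_2) *m (GLval v : 'M[F]_2).
Proof. by []. Qed.

Lemma SL2P u : reflect (\det (GLval u) = 1) (u \in S).
Proof. by rewrite in_S; apply: eqP. Qed.

Definition upper t : GL := glmx (mx2 1 t 0 1).
Definition lower t : GL := glmx (mx2 1 0 t 1).

Lemma upperE t : GLval (upper t) = mx2 1 t 0 1.
Proof. by rewrite glmxK // (det_upper, det_lower). Qed.

Lemma lowerE t : GLval (lower t) = mx2 1 0 t 1.
Proof. by rewrite glmxK // (det_upper, det_lower). Qed.

Lemma upper_SL2 t : upper t \in S.
Proof. by apply/SL2P; rewrite upperE det_upper. Qed.

Lemma lower_SL2 t : lower t \in S.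
Proof. by apply/SL2P; rewrite lowerE det_lower. Qed.

Lemma lowerX t n : (lower t ^+ n)%g = lower (t *+ n).
Proof.
elim: n => [|n IH]; apply: GLval_inj; first by rewrite lowerE -mx2_1.
by rewrite expgS IH GLM !lowerE mul_lower (mulrS t n).
Qed.

Lemma SL2_transvections (P : GL -> Prop) :
  (forall u v, P u -> P v -> P (u * v)%g) ->
  (forall t, P (upper t)) -> (forall t, P (lower t)) ->
  forall u, u \in S -> P u.
Proof.
move=> PM Pu Pl.
have main u : u \in S -> GLval u ord_max ord0 != 0 -> P u.
  move=> /SL2P; rewrite (mx2E (GLval u)) det_mx2 mxE /=.
  set a := GLval u _ _; set d := GLval u _ _; set b := GLval u _ _.
  set c := GLval u _ _ => det1 c0.
  suff -> : u = (upper ((a - 1) / c) * lower c * upper ((d - 1) / c))%g.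
    exact: PM (PM _ _ (Pu _) (Pl _)) (Pu _).
  apply: GLval_inj; rewrite !GLM !upperE lowerE (mx2E (GLval u)).
  exact: mx2_transvections c0 det1.
move=> u uS; have [c0|] := eqVneq (GLval u ord_max ord0) 0; last exact: main.
(* If the lower left entry vanishes, multiplying by [lower 1] replaces it by the upper left entry,
   which is then nonzero because the determinant is 1. *)
have -> : u = (lower (-1) * (lower 1 * u))%g.
  rewrite mulgA -[LHS]mul1g; congr (_ * _)%g; apply: GLval_inj.
  by rewrite GLM !lowerE mul_lower addNr -mx2_1.
apply: PM => //; apply: main; first by rewrite groupM ?lower_SL2.
rewrite GLM lowerE (mx2E (GLval u)) mul_mx2 mxE /= c0.
rewrite mul1r mulr0 addr0; apply/eqP=> a0; move/SL2P: uS.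
rewrite (mx2E (GLval u)) det_mx2 c0 a0 mulr0 mul0r subr0 => /eqP.
by rewrite eq_sym oner_eq0.
Qed.

(** Commuting with [upper 1] and [lower 1] already forces a scalar matrix, and the determinant makes
    the scalar a sign. *)
Lemma center_SL2P u :
  reflect (GLval u = 1%:M \/ GLval u = - 1%:M) (u \in 'Z(S)).
Proof.
apply: (iffP idP) => [/centerP[uS uC]|].
  have /(congr1 (@GLval _ _)) := uC _ (upper_SL2 1).
  have /(congr1 (@GLval _ _)) := uC _ (lower_SL2 1).
  move/SL2P: uS; rewrite !GLM upperE lowerE (mx2E (GLval u)) det_mx2.
  set a := GLval u _ _; set d := GLval u _ _; set b := GLval u _ _.
  set c := GLval u _ _ => det1.
  rewrite !mul_mx2 => eL eU.
  have := congr1 (fun M : 'M_2 => M ord0 ord0) eL.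
  have := congr1 (fun M : 'M_2 => M ord0 ord0) eU.
  have := congr1 (fun M : 'M_2 => M ord0 ord_max) eU.
  rewrite !mxE /= !(mulr0, mul0r, mulr1, mul1r, addr0, add0r) => e1 e2 e3.
  have b0 : b = 0 by apply: (addrI a); rewrite e3 addr0.
  have c0 : c = 0 by apply: (addrI a); rewrite -e2 addr0.
  have ad : a = d by move: e1; rewrite b0 !(addr0, add0r).
  have /eqP : a ^+ 2 = 1 by move: det1; rewrite b0 -ad mul0r subr0.
  rewrite sqrf_eq1 b0 c0 -ad mx2_1.
  case/orP=> /eqP->; [left | right] => //.
  by apply: mx2P; rewrite !mxE ?oppr0.
have S1 e : e ^+ 2 = 1 -> GLval u = e%:M -> u \in 'Z(S).
  move=> e2 uE; apply/centerP; split.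
    by apply/SL2P; rewrite uE det_scalar.
  move=> v _; apply: GLval_inj.
  by rewrite !GLM uE scalar_mxC.
case=> uE; [apply: (S1 1) | apply: (S1 (- 1))] => //; rewrite ?expr1n ?sqrrN ?expr1n //.
by rewrite uE raddfN.
Qed.

Lemma center_SL2_norm u : u \in 'N('Z(S))%g.
Proof.
have /fintype.subsetP sub := char_norms (center_char S); apply: sub.
apply/normP/eqP; rewrite eqEcard cardJg leqnn andbT.
apply/fintype.subsetP=> _ /imsetP[v /SL2P vS ->]; apply/SL2P.
by rewrite conjgE !GL_ME !detM GL_VE vS mul1r -detM mulVr ?det1 ?GL_unit.
Qed.

Lemma tr_conj u v : \tr (GLval (u ^ v)%g) = \tr (GLval u).
Proof.
by rewrite conjgE GLM mxtrace_mulC -GLM mulgK.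
Qed.

End SL2Matrices.

(** * Powers of matrices of determinant 1 and their traces *)

Section UnimodularPowers.
Local Open Scope ring_scope.
Variable K : fieldType.
Implicit Types M A B : 'M[K]_2.

Lemma mx2_add (a b c d a' b' c' d' : K) :
  mx2 a b c d + mx2 a' b' c' d' = mx2 (a + a') (b + b') (c + c') (d + d').
Proof. by apply: mx2P; rewrite !mxE. Qed.

Lemma mx2_scale (k a b c d : K) :
  k *: mx2 a b c d = mx2 (k * a) (k * b) (k * c) (k * d).
Proof. by apply: mx2P; rewrite !mxE. Qed.

Lemma Cayley_Hamilton2 M : \det M = 1 -> M *m M = \tr M *: M - 1%:M.
Proof.
rewrite (mx2E M) det_mx2 tr_mx2.
move: (M ord0 ord0) (M ord0 ord_max) (M ord_max ord0) (M ord_max ord_max).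
move=> a b c d det1; rewrite mul_mx2 mx2_scale -scaleN1r mx2_1 mx2_scale mx2_add.
have bc : b * c = a * d - 1 by rewrite -det1; ring.
by congr mx2; rewrite ?(mulrC c b) ?bc; ring.
Qed.

Lemma tr_sqr M : \det M = 1 -> \tr (M *m M) = \tr M ^+ 2 - 2%:R.
Proof.
by move=> dM; rewrite Cayley_Hamilton2 // raddfB /= mxtraceZ mxtrace1 expr2.
Qed.

Lemma det_expr M n : \det M = 1 -> \det (M ^+ n) = 1.
Proof.
by move=> dM; elim: n => [|n IH]; rewrite ?expr0 ?det1 // exprS det_mulmx dM IH mulr1.
Qed.

Lemma mulmx_span M (s t : K) : \det M = 1 ->
  M *m (s *: M - t%:M) = (s * \tr M - t) *: M - s%:M.
Proof.
move=> dM; rewrite mulmxBr -scalemxAr Cayley_Hamilton2 // mul_mx_scalar.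
by rewrite scalerBr scalerA scalemx1 scalerBl addrAC.
Qed.

Lemma expr_span M n : \det M = 1 ->
  exists s t : K, M ^+ n = s *: M - t%:M.
Proof.
move=> dM; elim: n => [|n [s [t IH]]].
  by exists 0, (-1); rewrite expr0 scale0r add0r raddfN opprK.
by exists (s * \tr M - t), s; rewrite exprS IH -mulmx_span.
Qed.

(** Here [M - 1] squares to zero, so the power is [1 + n (M - 1)]. *)
Lemma expr_parabolic M n : \det M = 1 -> \tr M = 2%:R ->
  M ^+ n = n%:R *: M - (n%:R - 1)%:M.
Proof.
move=> dM tM; elim: n => [|n IH].
  by rewrite expr0 scale0r !add0r raddfN opprK.
rewrite exprS IH -[LHS]/(M *m _) mulmx_span // tM -natr1.
by congr (_ *: _ - _%:M); ring.
Qed.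

(** The right side is [lam - mu] times the linear polynomial that interpolates the [n]-th power at
    [lam] and [mu], evaluated at [M]. Keeping the factor on the left avoids assuming distinct
    eigenvalues. *)
Lemma expr_eigen M n (lam mu : K) : \det M = 1 -> \tr M = lam + mu ->
  lam * mu = 1 ->
  (lam - mu) *: M ^+ n =
  (lam ^+ n - mu ^+ n) *: M - (lam ^+ n * mu - mu ^+ n * lam)%:M.
Proof.
move=> dM tM lm; elim: n => [|n IH].
  by rewrite !expr0 subrr scale0r !mul1r add0r -scalemx1 -scaleNr opprB.
rewrite exprS -[M * _]/(M *m _) scalemxAr IH mulmx_span // tM.
have e1 : lam ^+ n.+1 * mu = lam ^+ n by rewrite exprSr -mulrA lm mulr1.
have e2 : mu ^+ n.+1 * lam = mu ^+ n by rewrite exprSr -mulrA (mulrC mu) lm mulr1.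
by rewrite e1 e2; congr (_ *: _ - _); rewrite !exprSr; ring.
Qed.

(** The eigenvalues [lam] and [lam^-1] are distinct because [lam ^+ 2 != 1], and both have [n]-th
    power [e], since [e] is its own inverse. *)
Lemma expr_hyperbolic M n (lam e : K) : \det M = 1 ->
  lam != 0 -> lam ^+ 2 != 1 -> \tr M = lam + lam^-1 -> e ^+ 2 = 1 ->
  lam ^+ n = e -> M ^+ n = e%:M.
Proof.
move=> dM l0 l1 tM e2 le; have lm : lam - lam^-1 != 0.
  apply: contraNneq l1 => /eqP; rewrite subr_eq0 => /eqP el.
  by rewrite expr2 {2}el divff.
have ee : lam^-1 ^+ n = e.
  rewrite exprVn le; apply: (mulfI (_ : e != 0)).
    by apply/eqP=> e0; move/eqP: e2; rewrite e0 expr0n eq_sym oner_eq0.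
  rewrite divff -?expr2 ?e2 //.
  by apply/eqP=> e0; move/eqP: e2; rewrite e0 expr0n eq_sym oner_eq0.
apply: (scalerI lm); rewrite (expr_eigen _ dM tM (divff l0)) ee le subrr scale0r.
by rewrite add0r -mulrBr -scalemx1 -scaleNr -mulrN opprB mulrC -scalerA scalemx1.
Qed.

(* Writing [A ^+ n = s *: A - t%:M], the two trace conditions are linear in
   [(y, z)], and eliminating [t + e] from them leaves [s * x ^+ 2 = 0]. *)
Lemma twist_fixed_scalar A B n (e : K) : \det A = 1 ->
  let x := \tr A in let y := \tr B in let z := \tr (A *m B) in
  x ^+ 2 + y ^+ 2 + z ^+ 2 = x * y * z -> x != 0 ->
  y = e * \tr (A ^+ n *m B) -> z = e * \tr (A ^+ n *m (A *m B)) ->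
  e ^+ 2 = 1 -> exists q : K, A ^+ n = q%:M.
Proof.
move=> dA x y z xyz x0; have [s [t ->]] := expr_span n dA.
rewrite mulmxA !mulmxBl -!scalemxAl Cayley_Hamilton2 // mulmxBl -scalemxAl.
rewrite !mul_scalar_mx scale1r -!scalemxAl !raddfB /= !mxtraceZ.
rewrite -/x -/y -/z => ey ez e2.
have ee : e * e = 1 by rewrite -expr2.
have sz : s * z = (t + e) * y.
  have : e * y = s * z - t * y by rewrite {1}ey mulrA ee; ring.
  by move=> h; rewrite mulrDl h; ring.
have qz : (t + e) * z = s * (x * z - y).
  have : e * z = s * (x * z - y) - t * z by rewrite {1}ez mulrA ee; ring.
  by move=> h; rewrite mulrDl h; ring.
suff s0 : s = 0 by exists (- t); rewrite s0 scale0r add0r raddfN.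
have : s * x ^+ 2 = 0.
  have -> : x ^+ 2 = x * y * z - y ^+ 2 - z ^+ 2 by rewrite -xyz; ring.
  have -> : s * (x * y * z - y ^+ 2 - z ^+ 2) = s * (x * z - y) * y - s * z * z.
    by ring.
  by rewrite -qz sz; ring.
by move/eqP; rewrite mulf_eq0 expf_eq0 (negPf x0) orbF => /eqP.
Qed.

(** The determinant makes [q] a sign, so [A] or [-A] equals [A ^+ n.+1], the square of a unimodular
    matrix as [n] is odd; the trace of such a square is [t ^+ 2 - 2]. *)
Lemma odd_power_scalar A n (q : K) : odd n -> \det A = 1 -> A ^+ n = q%:M ->
  exists t : K, \tr A = t ^+ 2 - 2%:R \/ - \tr A = t ^+ 2 - 2%:R.
Proof.
move=> on dA An; have q2 : q ^+ 2 = 1.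
  by rewrite -(det_expr n dA) An det_scalar.
exists (\tr (A ^+ n.+1./2)); rewrite -tr_sqr ?det_expr //.
rewrite -[A ^+ _ *m _]/(A ^+ _ * A ^+ _) -exprD addnn.
have -> : (n.+1./2).*2 = n.+1 by rewrite -[RHS]odd_double_half /= on.
rewrite exprSr An -[_ * A]/(_ *m A) mul_scalar_mx mxtraceZ.
move/eqP: q2; rewrite sqrf_eq1 => /orP[]/eqP->; rewrite ?mul1r ?mulN1r; first by left.
by right.
Qed.

End UnimodularPowers.

(* Jorgensen's normal form of a pair of unimodular matrices with traces [x], [y],
   whose product has trace [z] and whose commutator is minus a unipotent. *)
Section Jorgensen.
Local Open Scope ring_scope.
Variables (K : fieldType) (x y z : K).
Hypotheses (z0 : z != 0) (xyz : x ^+ 2 + y ^+ 2 + z ^+ 2 = x * y * z).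

Definition Jorgensen_a : 'M[K]_2 := mx2 (x - y / z) (x / z ^+ 2) x (y / z).
Definition Jorgensen_b : 'M[K]_2 := mx2 (y - x / z) (- (y / z ^+ 2)) (- y) (x / z).

Let zz : x * y * z - x ^+ 2 - y ^+ 2 = z ^+ 2.
Proof. by rewrite -xyz; ring. Qed.

Lemma det_Jorgensen_a : \det Jorgensen_a = 1.
Proof.
rewrite det_mx2; transitivity ((x * y * z - x ^+ 2 - y ^+ 2) / z ^+ 2); first by field.
by rewrite zz divff // expf_neq0.
Qed.

Lemma det_Jorgensen_b : \det Jorgensen_b = 1.
Proof.
rewrite det_mx2; transitivity ((x * y * z - x ^+ 2 - y ^+ 2) / z ^+ 2); first by field.
by rewrite zz divff // expf_neq0.
Qed.

Lemma tr_Jorgensen_a : \tr Jorgensen_a = x.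
Proof. by rewrite tr_mx2 subrK. Qed.

Lemma tr_Jorgensen_b : \tr Jorgensen_b = y.
Proof. by rewrite tr_mx2 subrK. Qed.

Let zE : z = (x * y * z - x ^+ 2 - y ^+ 2) / z.
Proof. by rewrite zz expr2 mulfK. Qed.

Lemma Jorgensen_ab : Jorgensen_a *m Jorgensen_b = mx2 z (- z^-1) z 0.
Proof.
rewrite mul_mx2; congr mx2.
- by rewrite [RHS]zE; field.
- transitivity (- ((x * y * z - x ^+ 2 - y ^+ 2) / z ^+ 3)); first by field.
  by rewrite zz; field.
- by rewrite [RHS]zE; field.
- by field.
Qed.

Lemma Jorgensen_ba : Jorgensen_b *m Jorgensen_a = mx2 z z^-1 (- z) 0.
Proof.
rewrite mul_mx2; congr mx2.
- by rewrite [RHS]zE; field.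
- transitivity ((x * y * z - x ^+ 2 - y ^+ 2) / z ^+ 3); first by field.
  by rewrite zz; field.
- by rewrite [in RHS]zE; field.
- by field.
Qed.

(** The commutator is characterized by an equation without inverse matrices; only the inverse of the
    product [ba] is needed, and it is explicit. *)
Lemma Jorgensen_commutator (C : 'M[K]_2) :
  Jorgensen_b *m Jorgensen_a *m C = Jorgensen_a *m Jorgensen_b ->
  C = mx2 (-1) 0 (2%:R * z ^+ 2) (-1).
Proof.
move=> eC; have inj : mx2 0 (- z^-1) z z *m (Jorgensen_b *m Jorgensen_a) = 1%:M.
  by rewrite Jorgensen_ba mul_mx2 mx2_1; congr mx2; field.
rewrite -[C]mul1mx -inj -mulmxA eC Jorgensen_ab mul_mx2.
by congr mx2; field.
Qed.

End Jorgensen.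

(* [abs_point phi] is the point of the quotient by D(p) given by the surjection
   [phi] followed by reduction modulo the center [Z]. *)
Section ConjugacyPoints.
Variables (gT : finGroupType) (G Z : {group gT}).
Hypothesis normZ : forall u, u \in 'N(Z).
Implicit Types (phi psi : Pi -> gT) (alpha : Pi -> Pi).

Definition abs_point phi : set (set (Pi -> coset_of Z)) :=
  [set postcomp (conjg^~ (coset Z d)) (postcomp (coset Z) (conj_class G phi))
     | d in setT].

Lemma quotient_classE phi :
  postcomp (coset Z) (conj_class G phi) =
  [set conjg^~ (coset Z g) \o (coset Z \o phi) | g in [set` G]].
Proof.
rewrite /postcomp /conj_class image_comp; apply: eq_imagel => g _.
by apply/funext=> w /=; rewrite morphJ.
Qed.

Lemma mon_point alpha phi :
  (fun C : set (Pi -> coset_of Z) => [set psi \o alpha | psi in C]) @` abs_point phi =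
  abs_point (phi \o alpha).
Proof.
rewrite /abs_point !quotient_classE image_comp; apply: eq_imagel => d _.
by rewrite /postcomp /= !image_comp.
Qed.

Lemma point_eq phi psi : coset Z \o phi = coset Z \o psi -> abs_point phi = abs_point psi.
Proof. by move=> e; rewrite /abs_point !quotient_classE e. Qed.

(** The conjugator [h] combines the inner automorphism by an element of [G] with the outer action of
    [d]. *)
Lemma point_inj phi psi : abs_point phi = abs_point psi ->
  exists h, forall w, coset Z (phi w) = coset Z (psi w ^ h).
Proof.
rewrite /abs_point !quotient_classE => e.
have : [set postcomp (conjg^~ (coset Z d))
          [set conjg^~ (coset Z g) \o (coset Z \o phi) | g in [set` G]]
          | d in setT] (postcomp (conjg^~ (coset Z 1))
          [set conjg^~ (coset Z g) \o (coset Z \o phi) | g in [set` G]]).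
  by exists 1.
rewrite e => -[d _ ed].
have : postcomp (conjg^~ (coset Z 1))
  [set conjg^~ (coset Z g) \o (coset Z \o phi) | g in [set` G]] (coset Z \o phi).
  exists (coset Z \o phi); last by apply/funext=> w /=; rewrite morph1 conjg1.
  by exists 1; rewrite /= ?group1 //; apply/funext=> w /=; rewrite morph1 conjg1.
rewrite -ed => -[_ [g _ <-] ephi]; exists (g * d) => w.
by rewrite -[LHS](congr1 (@^~ w) ephi) /= !morphJ ?morphM // conjgM.
Qed.

End ConjugacyPoints.
Arguments abs_point {gT} G Z phi.

(** * The covers attached to PSL_2 and SL_2 *)

Section PSL2Points.
Variable p : nat.
Local Notation GL := {'GL_2['F_p]}.
Local Notation Z := ('Z(SL2 p))%G.

Lemma in_SL2 (u : GL) : (u \in SL2 p) = (\det (GLval u) == 1)%R.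
Proof. by rewrite inE. Qed.

Lemma SL2_normZ (u : GL) : u \in 'N(Z).
Proof. exact: (center_SL2_norm in_SL2). Qed.

Lemma mon_PSL2_point alpha (phi : Pi -> GL) :
  @mon (M_PSL2_m2_abs p) alpha (abs_point (SL2 p) Z phi) =
  abs_point (SL2 p) Z (phi \o alpha).
Proof. exact: (mon_point _ SL2_normZ). Qed.

Lemma mon_PSL2M alpha beta (x : cpoint (M_PSL2_m2_abs p)) :
  mon (alpha \o beta) x = mon beta (mon alpha x).
Proof.
rewrite /= image_comp; congr (_ @` x); apply/funext=> C /=.
by rewrite image_comp.
Qed.

Lemma PSL2_point_fiber (phi : Pi -> GL) : Epi (SL2 p) phi ->
  (\tr (GLval (phi [~ Pi_a, Pi_b])) = - 2%:R)%R ->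
  cfiber (M_PSL2_m2_abs p) (abs_point (SL2 p) Z phi).
Proof.
move=> phiE tr2; exists (SL2_to_PSL2 (conj_class (SL2 p) phi)); last by [].
exists (conj_class (SL2 p) phi) => //; split; first by exists phi.
by move=> _ [g _ <-] /=; rewrite tr_conj.
Qed.

(** Reduction modulo the center is an equivariant surjection of fibers: transitivity passes to the
    image and stabilizers can only grow. *)
Lemma congruence_cover_PSL2 : congruence_cover (M_SL2_m2_abs p) ->
  congruence_cover (M_PSL2_m2_abs p).
Proof.
pose f (O : cpoint (M_SL2_m2_abs p)) : cpoint (M_PSL2_m2_abs p) :=
  postcomp (coset Z) @` O.
have f_mon alpha O : mon alpha (f O) = f (mon alpha O).
  rewrite /f /= !image_comp; congr (_ @` O); apply/funext=> C /=.
  by rewrite /postcomp !image_comp.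
have f_orbit C : f [set postcomp (conjg^~ d) C | d in setT] =
    [set postcomp (conjg^~ (coset Z d)) (postcomp (coset Z) C) | d in setT].
  rewrite /f image_comp; apply: eq_imagel => d _ /=.
  rewrite /postcomp !image_comp; apply: eq_imagel => phi _.
  by apply/funext=> w /=; rewrite morphJ ?SL2_normZ.
have f_fiber : cfiber (M_PSL2_m2_abs p) = f @` cfiber (M_SL2_m2_abs p).
  rewrite /= !image_comp; apply: eq_imagel => C _ /=.
  by rewrite f_orbit.
move=> [[[x0 x0X] trans] [x xX [n n0 sub]]]; split; [split|].
- by exists (f x0); rewrite f_fiber; exists x0.
- rewrite f_fiber => _ _ [y yX <-] [z zX <-].
  by have [alpha Ha <-] := trans _ _ yX zX; exists alpha; rewrite ?f_mon.
- exists (f x); first by rewrite f_fiber; exists x.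
  by exists n => // alpha /sub[Ha ax]; split=> //; rewrite f_mon ax.
Qed.

End PSL2Points.

(** * The surjection attached to a Markoff solution *)

Section MarkoffHom.
Local Open Scope ring_scope.
Variable F : finFieldType.
Local Notation GL := {'GL_2[F]}.
Variable S : {group GL}.
Hypothesis in_S : forall u : GL, (u \in S) = (\det (GLval u) == 1).
Hypothesis prime_field : forall s t : F, s != 0 -> exists k, t = s *+ k.
Hypothesis two0 : 2%:R != 0 :> F.
Variables x y z : F.
Hypotheses (z0 : z != 0) (xyz : x ^+ 2 + y ^+ 2 + z ^+ 2 = x * y * z).

Definition Markoff_hom : Pi -> GL :=
  pair_hom (glmx (Jorgensen_a x y z)) (glmx (Jorgensen_b x y z)).

Lemma Markoff_homM : is_hom Markoff_hom.
Proof. exact: pair_homM. Qed.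

Lemma Markoff_hom_a : GLval (Markoff_hom Pi_a) = Jorgensen_a x y z.
Proof. by rewrite /Markoff_hom pair_hom_a glmxK // det_Jorgensen_a. Qed.

Lemma Markoff_hom_b : GLval (Markoff_hom Pi_b) = Jorgensen_b x y z.
Proof. by rewrite /Markoff_hom pair_hom_b glmxK // det_Jorgensen_b. Qed.

Lemma Markoff_hom_ab : GLval (Markoff_hom (Pi_a * Pi_b)%g) = mx2 z (- z^-1) z 0.
Proof. by rewrite Markoff_homM GLM Markoff_hom_a Markoff_hom_b Jorgensen_ab. Qed.

Lemma Markoff_hom_comm : GLval (Markoff_hom [~ Pi_a, Pi_b]%g) =
  mx2 (-1) 0 (2%:R * z ^+ 2) (-1).
Proof.
apply: (Jorgensen_commutator z0 xyz).
have : (Pi_a * Pi_b = Pi_b * Pi_a * [~ Pi_a, Pi_b])%g by rewrite commgC.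
move: [~ Pi_a, Pi_b]%g => c /(congr1 (fun w => GLval (Markoff_hom w))).
rewrite (Markoff_homM Pi_a Pi_b) (Markoff_homM (Pi_b * Pi_a)%g c).
rewrite (Markoff_homM Pi_b Pi_a) (GLM (Markoff_hom Pi_a)).
rewrite (GLM (_ * _)%g) (GLM (Markoff_hom Pi_b)).
by rewrite Markoff_hom_a Markoff_hom_b => <-.
Qed.

(** The squared commutator is a nontrivial lower transvection. Over a prime field its powers are all
    lower transvections, and conjugation by the image of [ab] turns these into the upper ones. *)
Lemma Markoff_hom_Epi : Epi S Markoff_hom.
Proof.
have phiM := Markoff_homM; split=> //.
have genS t : Markoff_hom (fggen t) \in S.
  rewrite in_S; apply/eqP; have [->|->] := I2_cases t.
    by rewrite Markoff_hom_a (det_Jorgensen_a z0 xyz).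
  by rewrite Markoff_hom_b (det_Jorgensen_b z0 xyz).
apply/seteqP; split=> u /=.
  move=> [w _ <-]; elim/freeGroup_elim: w => [|t w IH|t w IH].
  - by rewrite (is_hom1 phiM) group1.
  - by rewrite phiM groupM.
  - by rewrite phiM groupM // (is_homV phiM) groupV.
move=> uS; pose P v := exists w, Markoff_hom w = v.
have PM v v' : P v -> P v' -> P (v * v')%g.
  by move=> [w <-] [w' <-]; exists (w * w')%g; rewrite phiM.
have PX v n : P v -> P (v ^+ n)%g.
  by move=> [w <-]; exists (w ^+ n)%g; rewrite (is_homX phiM).
have PV v : P v -> P (v^-1)%g.
  by move=> [w <-]; exists (w^-1)%g; rewrite (is_homV phiM).
have Pl t : P (lower t).
  have P4 : P (lower (- (2%:R * 2%:R * z ^+ 2))).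
    have [m Pm mE] : exists2 m, P m & GLval m = mx2 (-1) 0 (2%:R * z ^+ 2) (-1).
      by exists (Markoff_hom [~ Pi_a, Pi_b]%g); [eexists | exact: Markoff_hom_comm].
    have -> : lower (- (2%:R * 2%:R * z ^+ 2)) = (m * m)%g.
      by apply: GLval_inj; rewrite GLM mE lowerE mul_mx2; congr mx2; ring.
    exact: PM.
  have [|k ->] := @prime_field (- (2%:R * 2%:R * z ^+ 2)) t.
    by rewrite oppr_eq0 !mulf_neq0 // expf_neq0.
  by rewrite -lowerX; apply: PX.
have Pu t : P (upper t).
  have [m Pm mE] : exists2 m, P m & GLval m = mx2 z (- z^-1) z 0.
    by exists (Markoff_hom (Pi_a * Pi_b)%g); [eexists | exact: Markoff_hom_ab].
  (* The matrix [m] maps the second basis vector to a multiple of the first, so it conjugates lower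
     transvections to upper ones. *)
  have -> : upper t = (m * lower (- (t * z ^+ 2)) * m^-1)%g.
    apply: (mulIg m); rewrite mulgKV.
    apply: GLval_inj; rewrite !GLM lowerE upperE mE !mul_mx2.
    by congr mx2; field.
  exact: PM (PM _ _ Pm (Pl _)) (PV _ Pm).
by have [w <-] := SL2_transvections in_S PM Pu Pl uS; exists w.
Qed.

End MarkoffHom.

(** * Dehn twists fixing the point of a homomorphism *)

Section TwistedPoints.
Local Open Scope ring_scope.
Variable F : finFieldType.
Local Notation GL := {'GL_2[F]}.
Variable S : {group GL}.
Hypothesis in_S : forall u : GL, (u \in S) = (\det (GLval u) == 1).
Local Notation Z := ('Z(S))%G.
Variable phi : Pi -> GL.
Hypothesis phiM : is_hom phi.
Let u := phi Pi_a.
Let v := phi Pi_b.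

Lemma scalar_center (w : GL) (e : F) : e ^+ 2 = 1 -> GLval w = e%:M -> w \in Z.
Proof.
move=> /eqP; rewrite sqrf_eq1 => /orP[]/eqP-> wE; apply/(center_SL2P in_S).
  by left.
by right; rewrite wE raddfN.
Qed.

Lemma coset_hom : is_hom (coset Z \o phi).
Proof. by move=> w w' /=; rewrite phiM morphM ?(center_SL2_norm in_S). Qed.

Lemma GLvalX (w : GL) n : GLval (w ^+ n)%g = GLval w ^+ n.
Proof. by elim: n => [|n IH]; rewrite ?expg0 // expgS exprS GL_ME IH. Qed.

Lemma expg_center (w : GL) (r k : nat) (e : F) : e ^+ 2 = 1 ->
  GLval w ^+ r = e%:M -> (r %| k)%N -> (w ^+ k)%g \in Z.
Proof.
move=> e2 wr /dvdnP[m ->]; rewrite mulnC expgM groupX //.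
by apply: (scalar_center e2); rewrite GLvalX.
Qed.

Lemma point_twist_a k : (u ^+ k)%g \in Z ->
  abs_point S Z (phi \o twist_a k) = abs_point S Z phi.
Proof.
move=> uk; apply: (point_eq _ (center_SL2_norm in_S)); apply: Pi_hom_eq.
- exact: (is_hom_comp coset_hom (pair_homM _ _)).
- exact: coset_hom.
- by rewrite /= /twist_a pair_hom_a.
- rewrite /= /twist_a pair_hom_b phiM (is_homX phiM) -/u.
  exact: (coset_kerl _ uk).
Qed.

Lemma point_twist_b k : (v ^+ k)%g \in Z ->
  abs_point S Z (phi \o twist_b k) = abs_point S Z phi.
Proof.
move=> uk; apply: (point_eq _ (center_SL2_norm in_S)); apply: Pi_hom_eq.
- exact: (is_hom_comp coset_hom (pair_homM _ _)).
- exact: coset_hom.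
- rewrite /= /twist_b pair_hom_a phiM (is_homX phiM) -/v.
  exact: (coset_kerl _ uk).
- by rewrite /= /twist_b pair_hom_b.
Qed.

Lemma coset_center_eq (w w' : GL) : coset Z w = coset Z w' ->
  exists2 e : F, e ^+ 2 = 1 & GLval w = e *: GLval w'.
Proof.
move=> /(kercoset_rcoset (center_SL2_norm in_S _) (center_SL2_norm in_S _)).
move=> [c /(center_SL2P in_S) cZ ->].
have [e e2 cE] : exists2 e : F, e ^+ 2 = 1 & GLval c = e%:M.
  case: cZ => ->; first by exists 1; rewrite ?expr1n.
  by exists (-1); rewrite ?sqrrN ?expr1n // raddfN.
by exists e => //; rewrite GLM cE mul_scalar_mx.
Qed.

(** Equality of points gives conjugacy up to signs. Comparing traces on [b] and [ab] then yields the
    two conditions of [twist_fixed_scalar]. *)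
Lemma point_twist_a_scalar k (x y z : F) : 2%:R != 0 :> F ->
  \det (GLval u) = 1 ->
  \tr (GLval u) = x -> \tr (GLval v) = y -> \tr (GLval (phi (Pi_a * Pi_b)%g)) = z ->
  x ^+ 2 + y ^+ 2 + z ^+ 2 = x * y * z -> x != 0 ->
  abs_point S Z (phi \o twist_a k) = abs_point S Z phi ->
  exists q : F, GLval u ^+ k = q%:M.
Proof.
move=> two0 du ex ey ez xyz x0 /(point_inj (center_SL2_norm in_S))[h hP].
have := coset_center_eq (hP Pi_a); have := coset_center_eq (hP Pi_b).
rewrite /comp /twist_a pair_hom_a pair_hom_b phiM (is_homX phiM) -/u -/v.
move=> [e2 e2P eB] [e1 e1P eA].
(* The sign -1 would give [x = - x], impossible for nonzero [x] in odd characteristic. *)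
have e11 : e1 = 1.
  have := congr1 mxtrace eA; rewrite mxtraceZ tr_conj ex => /eqP.
  move/eqP: e1P; rewrite sqrf_eq1 => /orP[]/eqP-> //.
  rewrite mulN1r -addr_eq0 -mulr2n -mulr_natl mulf_eq0 (negPf x0) orbF.
  by rewrite (negPf two0).
have euv : GLval (phi (Pi_a * Pi_b)%g) = GLval u *m GLval v by rewrite phiM GLM.
have etB : \tr (GLval u ^+ k *m GLval v) = e2 * y.
  by rewrite -GLvalX -GLM eB mxtraceZ tr_conj ey.
have etAB : \tr (GLval u ^+ k *m (GLval u *m GLval v)) = e2 * z.
  have -> : GLval u ^+ k *m (GLval u *m GLval v) = GLval (u * (u ^+ k * v))%g.
    by rewrite mulgA -expgS expgSr (GLM (_ * _)%g) GLM GLvalX mulmxA.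
  rewrite GLM eB [X in X *m _]eA e11 scale1r -scalemxAr mxtraceZ -GLM -conjMg.
  by rewrite tr_conj GLM -euv ez.
have e22 : e2 * e2 = 1 by rewrite -expr2.
apply: (twist_fixed_scalar (B := GLval v) (e := e2)) => //; rewrite -?euv ?ex ?ey ?ez //.
  by rewrite etB mulrA e22 mul1r.
by rewrite euv etAB mulrA e22 mul1r.
Qed.

End TwistedPoints.

(** * Markoff solutions over F_p with prescribed kinds of traces *)

Section FiniteFieldMarkoff.
Local Open Scope ring_scope.
Variables (p : nat) (F : finFieldType).
Hypotheses (p_pr : prime p) (p5 : (5 <= p)%N) (cardF : #|F| = p).
Hypothesis natF : forall n, (n%:R == 0 :> F) = (p %| n)%N.

Lemma small_natF n : (0 < n < p)%N -> n%:R != 0 :> F.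
Proof. by move=> /andP[n0 np]; rewrite natF gtnNdvd. Qed.

Lemma expf_pred (x : F) : x != 0 -> x ^+ p.-1 = 1.
Proof.
move=> x0; apply: (mulfI x0); rewrite mulr1 -exprS prednK ?prime_gt0 //.
by rewrite -cardF expf_card.
Qed.

(** The root is the power (p - 1)/4 of a primitive root. *)
Lemma sqrt_opp1 : (p %% 4 = 1)%N -> exists i : F, i ^+ 2 = -1.
Proof.
move=> p4; pose rs := [seq x <- enum F | x != 0].
have p1 : (0 < p.-1)%N by lia.
have sz : (p.-1 <= size rs)%N.
  have -> : rs = enum (predC1 (0 : F)) by rewrite /rs enumT.
  by rewrite -cardE cardC1 cardF.
have /hasP[g _ gP] : has (p.-1).-primitive_root rs.
  apply: has_prim_root => //; last by rewrite filter_uniq ?enum_uniq.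
  apply/allP=> x; rewrite mem_filter => /andP[x0 _]; apply/unity_rootP.
  exact: expf_pred.
have pE : p.-1 = (4 * (p.-1 %/ 4))%N.
  by move: p4; lia.
exists (g ^+ (p.-1 %/ 4)); rewrite -exprM.
have : (g ^+ (p.-1 %/ 4 * 2)) ^+ 2 = 1.
  by rewrite -exprM -mulnA mulnC -pE (prim_expr_order gP).
move/eqP; rewrite sqrf_eq1 => /orP[|/eqP//].
rewrite -(prim_order_dvd gP) => /dvdn_leq; lia.
Qed.

Section ThreeModFour.
Hypothesis p3 : (p %% 4 = 3)%N.

Let oddh : odd p.-1./2.
Proof. move: p3; lia. Qed.

Let hE : p.-1 = (p.-1./2 * 2)%N.
Proof. move: p3; lia. Qed.

Lemma opp1_nonsquare (b : F) : b ^+ 2 != -1.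
Proof.
apply/eqP=> b2; have b0 : b != 0.
  by apply/eqP=> b0; move/eqP: b2; rewrite b0 expr0n eq_sym oppr_eq0 oner_eq0.
have := expf_pred b0; rewrite hE mulnC exprM b2 -signr_odd oddh expr1 => /eqP.
by rewrite eq_sym -addr_eq0 -(natrD _ 1 1) (negPf (small_natF _)) //; lia.
Qed.

Lemma square_or_opp (a : F) : exists b, a = b ^+ 2 \/ a = - b ^+ 2.
Proof.
have [->|a0] := eqVneq a 0; first by exists 0; left; rewrite expr0n.
(* The square of this candidate is [a] times [a ^+ p.-1./2], and the latter factor is a sign. *)
exists (a ^+ (p.+1 %/ 4)); rewrite -exprM.
have -> : (p.+1 %/ 4 * 2)%N = (p.-1./2).+1 by move: p3; lia.
have : (a ^+ p.-1./2) ^+ 2 = 1 by rewrite -exprM -hE expf_pred.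
move/eqP; rewrite sqrf_eq1 exprS => /orP[]/eqP->; [left|right]; first by rewrite mulr1.
by rewrite mulrN1 opprK.
Qed.

Lemma sum_squares_eq0 (a b : F) : a ^+ 2 + b ^+ 2 = 0 -> a = 0.
Proof.
have [-> |b0] := eqVneq b 0.
  by rewrite expr0n addr0 => /eqP; rewrite expf_eq0 => /eqP.
move=> ab; have := opp1_nonsquare (a / b); case/eqP.
by rewrite expr_div_n (eqP (_ : a ^+ 2 == - b ^+ 2)) -?addr_eq0 ?ab // mulNr divff // expf_neq0.
Qed.

(* Not all of 4, ..., p - 1 are squares since [-1] is not; starting the run at 4
   rather than at 1 is what ensures [t ^+ 2 != 1]. *)
Lemma nonsquare_succ_square : exists t m : F,
  [/\ t != 0, t ^+ 2 != 1, m != 0 & 1 + t ^+ 2 = - m ^+ 2].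
Proof.
have : exists2 j, (4 <= j < p.-1)%N & [exists b : F, j%:R == b ^+ 2] &&
    ~~ [exists b : F, j.+1%:R == b ^+ 2].
  apply: contrapT => H.
  have sq j : (4 <= j < p)%N -> [exists b : F, j%:R == b ^+ 2].
    elim: j => [//|j IH] /andP[j4 jp]; have [j3|j4'] := leqP j 3.
      have -> : j.+1 = (2 * 2)%N by lia.
      by apply/existsP; exists 2%:R; rewrite natrM expr2.
    have jI : [exists b : F, j%:R == b ^+ 2] by apply: IH; lia.
    apply: contrapT => /negP nj; apply: H; exists j; first lia.
    by rewrite jI.
  have /existsP[b /eqP] := sq p.-1 ltac:(move: p3; lia).
  have -> : p.-1%:R = -1 :> F.
    apply/eqP; rewrite -addr_eq0 -(natrD _ _ 1) natF addn1 prednK ?dvdnn //; lia.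
  by move=> e; have := opp1_nonsquare b; rewrite -e eqxx.
move=> [j jP /andP[/existsP[t /eqP tE] /existsPn nsq]].
have [m [e|e]] := square_or_opp (j.+1%:R : F).
  by have := nsq m; rewrite e eqxx.
exists t, m; split.
- apply/eqP=> t0; have := @small_natF j ltac:(lia).
  by rewrite tE t0 expr0n eqxx.
- rewrite -tE -subr_eq0 (_ : _ - 1 = (j - 1)%:R); last by rewrite natrB //; lia.
  by apply: small_natF; lia.
- apply/eqP=> m0; have := nsq 0; rewrite e m0 !expr0n /= oppr0 eqxx //.
- by rewrite -e -tE -nat1r.
Qed.

End ThreeModFour.
Lemma hyperbolic_trace_inj (w w' : F) : w != 0 -> w' != 0 ->
  w + w^-1 = w' + w'^-1 -> w' = w \/ w' = w^-1.
Proof.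
move=> w0 w0' e; have : (w - w') * (w * w' - 1) = 0.
  transitivity (w * w' * (w + w^-1 - (w' + w'^-1))); first by field; rewrite ?w0 ?w0'.
  by rewrite e subrr mulr0.
move/eqP; rewrite mulf_eq0 !subr_eq0 => /orP[/eqP->|/eqP e1]; first by left.
by right; apply: (mulfI w0); rewrite e1 divff.
Qed.

(** Choose one preimage of each trace. The chosen elements and their inverses cover the p - 1
    nonzero elements, and 1 and -1 are counted twice. *)
Lemma card_hyperbolic_traces :
  (p.+1 <= 2 * #|[set (w + w^-1)%R | w : F & (w != 0)%R]%SET|)%N.
Proof.
set H := [set _ | _ in _]%SET.
(* The default 1 is never reached on [H], where a preimage exists. *)
pose g h : F := odflt 1 [pick w | (w != 0) && (w + w^-1 == h)].
have gP w : w != 0 -> g (w + w^-1) = w \/ g (w + w^-1) = w^-1.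
  move=> w0; rewrite /g; case: pickP => [v /andP[v0 /eqP e]|/(_ w)].
    by apply: hyperbolic_trace_inj.
  by rewrite w0 eqxx.
pose A := [set g h | h in H]%SET; pose A' := [set a^-1 | a in A]%SET.
have gA w : w != 0 -> g (w + w^-1) \in A.
  by move=> w0; do 2!apply: imset_f; rewrite inE.
have cA : (#|A| <= #|H|)%N by apply: leq_imset_card.
have cA' : (#|A'| <= #|A|)%N by apply: leq_imset_card.
have sub : [set w | w != 0]%SET \subset A :|: A'.
  apply/fintype.subsetP=> w; rewrite !inE => w0; apply/orP.
  have [e|e] := gP w w0; [left | right]; first by rewrite -{1}e gA.
  by apply/imsetP; exists (g (w + w^-1)); rewrite ?gA // e invrK.
have sub2 : [set 1; -1]%SET \subset A :&: A'.
  apply/fintype.subsetP=> w; rewrite !inE => w1.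
  have wV : w^-1 = w by case/orP: w1 => /eqP->; rewrite ?invrN invr1.
  have w0 : w != 0 by case/orP: w1 => /eqP->; rewrite ?oppr_eq0 oner_eq0.
  have gw : g (w + w^-1) = w by have [|] := gP w w0; rewrite ?wV.
  rewrite -{1}gw gA //=; apply/imsetP; exists w; last by rewrite wV.
  by rewrite -{1}gw gA.
have := subset_leq_card sub; have := subset_leq_card sub2; rewrite cards2.
have -> : (1 != -1 :> F) by rewrite -addr_eq0 -(natrD _ 1 1) small_natF //; lia.
have -> : #|[set w : F | (w != 0)%R]%SET| = p.-1.
  rewrite (_ : [set _ | _]%SET = [set~ 0]%SET); last by apply/setP=> w; rewrite !inE.
  by rewrite cardsC1 cardF.
have UI := cardsUI A A'; move=> /= c2 cU; move: c2 cU cA cA' UI (prime_gt0 p_pr).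
move: #|_| #|_| #|_| #|_| #|_|; lia.
Qed.

(* The sets [rho H] and [0 |: H], for [H] the traces [w + w^-1], together have more
   than [p] elements. *)
Lemma hyperbolic_pair (rho : F) : rho != 0 ->
  (forall w, w != 0 -> rho * (w + w^-1) != 0) ->
  exists w v : F, [/\ w != 0, v != 0 & rho * (w + w^-1) = v + v^-1].
Proof.
move=> rho0 nz; have := card_hyperbolic_traces; set H := [set _ | _ in _]%SET => cH.
have H0 : 0 \notin H.
  apply/imsetP=> -[w]; rewrite inE => w0 e.
  by have := nz w w0; rewrite -e mulr0 eqxx.
pose R := [set rho * h | h in H]%SET.
have cR : #|R| = #|H| by apply: card_imset; apply: mulfI.
have : R :&: (0 |: H) != finset.set0.
  rewrite -card_gt0; have := cardsUI R (0 |: H); have := max_card (R :|: (0 |: H)).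
  rewrite cardsU1 H0 cR cardF /= add1n; move: cH.
  move: #|H| #|_| #|_|; lia.
case/set0Pn=> y; rewrite !inE => /andP[/imsetP[_ /imsetP[w + ->] ->]].
rewrite inE => w0; rewrite (negPf (nz w w0)) => /imsetP[v].
by rewrite inE => v0 e; exists w, v.
Qed.

(** For [x = 2 + 1/2] the equation is the conic [(z - 2y)(z - y/2) = -25/4], and setting the second
    factor to [5w/2] parametrizes it with [y = 5/3 (w + 1/w)]. Then [hyperbolic_pair] makes [y] a
    hyperbolic trace too. *)
Lemma hyperbolic_Markoff : (p %% 4 = 3)%N -> exists w v : F,
  let x := 2%:R + 2%:R^-1 in let y := v + v^-1 in
  let z := 5%:R / 3%:R * (2%:R * w + (2%:R * w)^-1) in
  [/\ v != 0, v ^+ 2 != 1, z != 0 & x ^+ 2 + y ^+ 2 + z ^+ 2 = x * y * z].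
Proof.
move=> p3; have p7 : (5 < p)%N by lia.
have [n2 n3 n5] : [/\ 2%:R != 0 :> F, 3%:R != 0 :> F & 5%:R != 0 :> F].
  by split; apply: small_natF; lia.
have x0 : 2%:R + 2%:R^-1 != 0 :> F.
  by rewrite (_ : _ + _ = 5%:R / 2%:R) ?mulf_neq0 ?invr_neq0 //; field.
have xyz w : w != 0 -> let x := 2%:R + 2%:R^-1 in
    let y := 5%:R / 3%:R * (w + w^-1) in
    let z := 5%:R / 3%:R * (2%:R * w + (2%:R * w)^-1) in
    x ^+ 2 + y ^+ 2 + z ^+ 2 = x * y * z :> F.
  by move=> w0 x y z; rewrite /x /y /z; field; rewrite w0 n2 n3.
have [||w [v [w0 v0 e]]] := @hyperbolic_pair (5%:R / 3%:R).
- by rewrite mulf_neq0 ?invr_neq0.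
- move=> w w0; apply/eqP=> y0; have /= := xyz w w0; rewrite y0 expr0n addr0.
  by rewrite mulr0 mul0r => /(sum_squares_eq0 p3)/eqP; rewrite (negPf x0).
exists w, v => x y z; have {}xyz : x ^+ 2 + y ^+ 2 + z ^+ 2 = x * y * z.
  by rewrite /y -e; apply: xyz.
split=> //.
  (* If [v] is a sign, then [y] is 2 or -2 and the Markoff equation becomes [4 + (x - z)^2 = 0] or
     [4 + (x + z)^2 = 0]. *)
  apply/eqP=> v2; have y2 : y ^+ 2 = 2%:R ^+ 2.
    have vV : v^-1 = v by apply: (mulfI v0); rewrite divff // -v2 expr2.
    transitivity (2%:R ^+ 2 * v ^+ 2); last by rewrite v2 mulr1.
    by rewrite /y vV; ring.
  move/eqP: y2; rewrite eqf_sqr => ye; case/eqP: n2.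
  case/orP: ye => /eqP ye.
    apply: (sum_squares_eq0 p3 (b := x - z)).
    transitivity (x ^+ 2 + y ^+ 2 + z ^+ 2 - x * y * z); last by rewrite xyz subrr.
    by rewrite ye; ring.
  apply: (sum_squares_eq0 p3 (b := x + z)).
  transitivity (x ^+ 2 + y ^+ 2 + z ^+ 2 - x * y * z); last by rewrite xyz subrr.
  by rewrite ye; ring.
apply/eqP=> z0; move: xyz; rewrite z0 expr0n addr0 mulr0 => /(sum_squares_eq0 p3)/eqP.
by rewrite (negPf x0).
Qed.

Lemma elliptic_Markoff : (p %% 4 = 3)%N -> exists x y z : F,
  [/\ z != 0, x != 0, x ^+ 2 + y ^+ 2 + z ^+ 2 = x * y * z &
    forall s, x <> s ^+ 2 - 2%:R /\ - x <> s ^+ 2 - 2%:R].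
Proof.
move=> p3; have n2 : 2%:R != 0 :> F by apply: small_natF; lia.
have n4 : 4%:R != 0 :> F by apply: small_natF; lia.
have [t [m [t0 t1 m0 tm]]] := nonsquare_succ_square p3.
(* This choice gives [2 + x = -(2/m)^2] and, since [1 + m^2 = -t^2], also [2 - x = -(2t/m)^2]: both
   are nonsquares. *)
pose x : F := - 2%:R - 2%:R * 2%:R / m ^+ 2.
have xE : x = 2%:R * (t ^+ 2 - 1) / m ^+ 2.
  have -> : t ^+ 2 - 1 = - m ^+ 2 - 2%:R by rewrite -tm; ring.
  by rewrite /x; field.
have x0 : x != 0 by rewrite xE !mulf_neq0 ?invr_neq0 ?expf_neq0 // subr_eq0.
(* With [z = - x m / 2], the discriminant of the Markoff equation as a quadratic in [y] is
   [(2x/m)^2], and this [y] is one of its roots. *)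
exists x, (x / m - x ^+ 2 * m / (2%:R * 2%:R)), (- (x * m / 2%:R)); split=> //.
- by rewrite oppr_eq0 !mulf_neq0 ?invr_neq0.
- by rewrite /x; field; rewrite ?m0 ?n2 ?n4.
move=> s; split=> e.
  have /eqP[] := opp1_nonsquare p3 (s * m / 2%:R).
  transitivity ((s ^+ 2 - 2%:R + 2%:R) * m ^+ 2 / 2%:R ^+ 2).
    by field; rewrite ?n2 ?n4.
  by rewrite -e /x; field; rewrite ?m0 ?n2 ?n4.
have /eqP[] := opp1_nonsquare p3 (s * m / (2%:R * t)).
transitivity ((s ^+ 2 - 2%:R + 2%:R) * m ^+ 2 / (2%:R * t) ^+ 2).
  by field; rewrite ?t0 ?n2 ?n4.
rewrite -e xE; transitivity ((1 + m ^+ 2 - t ^+ 2) / (2%:R * t ^+ 2)).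
  by field; rewrite ?t0 ?m0 ?n2 ?n4.
have -> : m ^+ 2 = - (1 + t ^+ 2) by rewrite tm opprK.
by field; rewrite ?t0 ?n2 ?n4.
Qed.

End FiniteFieldMarkoff.

(** * The contradiction in each residue class modulo 4 *)

Section SmallTraces.
Local Open Scope ring_scope.
Variable K : fieldType.
Implicit Types M : 'M[K]_2.

Lemma expr6_tr0 M : \det M = 1 -> \tr M = 0 -> M ^+ 6 = (-1)%:M.
Proof.
move=> dM tM; have M2 : M ^+ 2 = (-1)%:M.
  by rewrite expr2 -[LHS]/(M *m M) Cayley_Hamilton2 // tM scale0r add0r raddfN.
by rewrite (exprM _ 2 3) M2 -rmorphXn /= -signr_odd expr1.
Qed.

Lemma expr6_tr1 M : \det M = 1 -> \tr M = 1 -> M ^+ 6 = 1%:M.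
Proof.
move=> dM tM; have M3 : M ^+ 3 = (-1)%:M.
  rewrite exprS expr2 -[LHS]/(M *m (M *m M)) Cayley_Hamilton2 //.
  by rewrite mulmx_span // tM mulr1 subrr scale0r add0r raddfN.
by rewrite (exprM _ 3 2) M3 -rmorphXn /= sqrrN expr1n.
Qed.

End SmallTraces.

Section Noncongruence.
Local Open Scope ring_scope.
Variable p : nat.
Hypotheses (p_pr : prime p) (p5 : (5 <= p)%N).
Local Notation F := 'F_p.

Lemma Fp_nat n : (n%:R == 0 :> F) = (p %| n)%N.
Proof. by rewrite -(dvdn_pcharf (pchar_Fp p_pr)). Qed.

Lemma Fp_prime_field (s t : F) : s != 0 -> exists k, t = s *+ k.
Proof.
move=> s0; exists (val (t / s)); rewrite -mulr_natr natr_Zp.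
by rewrite mulrC divfK.
Qed.

Lemma Fp_two : 2%:R != 0 :> F.
Proof. by apply: (small_natF Fp_nat); lia. Qed.

Lemma Markoff_point_fiber (x y z : F) : z != 0 ->
  x ^+ 2 + y ^+ 2 + z ^+ 2 = x * y * z ->
  cfiber (M_PSL2_m2_abs p) (abs_point (SL2 p) 'Z(SL2 p)%G (Markoff_hom x y z)).
Proof.
move=> z0 xyz; apply: PSL2_point_fiber.
  exact: (Markoff_hom_Epi (@in_SL2 p) Fp_prime_field Fp_two z0 xyz).
by rewrite (Markoff_hom_comm z0 xyz) tr_mx2 -opprD.
Qed.

(** This restates [fixed_orbit] in terms of matrices: the first solution supplies the fixed point,
    the second the orbit whose length is tested. *)
Lemma congruence_twist_scalar (l r : nat) (x y z x' y' z' e1 e2 : F) :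
  congruence_cover (M_PSL2_m2_abs p) ->
  prime l -> (0 < r)%N -> ~~ (l %| r)%N ->
  z != 0 -> x ^+ 2 + y ^+ 2 + z ^+ 2 = x * y * z ->
  e1 ^+ 2 = 1 -> Jorgensen_a x y z ^+ r = e1%:M ->
  e2 ^+ 2 = 1 -> Jorgensen_b x y z ^+ r = e2%:M ->
  z' != 0 -> x' ^+ 2 + y' ^+ 2 + z' ^+ 2 = x' * y' * z' -> x' != 0 ->
  exists2 e, ~~ (l %| e)%N & exists q, Jorgensen_a x' y' z' ^+ e = q%:M.
Proof.
move=> [conn [w wX [n n0 sub]]] lp r0 lr z0 xyz e11 ea e22 eb z0' xyz' x0'.
have phiM := Markoff_homM x y z; have phiM' := Markoff_homM x' y' z'.
have := fixed_orbit (@mon_PSL2M p) lp r0 lr n0 conn wX sub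
  (Markoff_point_fiber z0 xyz) _ _ (Markoff_point_fiber z0' xyz').
case=> [k rk|k rk|e le fixed].
- rewrite mon_PSL2_point; apply: (point_twist_a (@in_SL2 p)) => //.
  by apply: (expg_center (@in_SL2 p) e11 _ rk); rewrite Markoff_hom_a.
- rewrite mon_PSL2_point; apply: (point_twist_b (@in_SL2 p)) => //.
  by apply: (expg_center (@in_SL2 p) e22 _ rk); rewrite Markoff_hom_b.
exists e => //; rewrite mon_PSL2_point in fixed.
rewrite -(Markoff_hom_a z0' xyz').
apply: (point_twist_a_scalar (@in_SL2 p) phiM' Fp_two _ _ _ _ xyz' x0' fixed).
- by rewrite (Markoff_hom_a z0' xyz') (det_Jorgensen_a z0' xyz').
- by rewrite (Markoff_hom_a z0' xyz') tr_Jorgensen_a.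
- by rewrite (Markoff_hom_b z0' xyz') tr_Jorgensen_b.
- by rewrite (Markoff_hom_ab z0' xyz') tr_mx2 addr0.
Qed.

Lemma noncongruence_1mod4 : (p %% 4 = 1)%N -> noncongruence (M_PSL2_m2_abs p).
Proof.
move=> p4 cong.
have [i i2] : exists i : F, i ^+ 2 = -1.
  exact: (sqrt_opp1 p_pr p5 (card_Fp p_pr) p4).
have n2 := Fp_two.
have i0 : i != 0.
  by apply/eqP=> i0; move/eqP: i2; rewrite i0 expr0n eq_sym oppr_eq0 oner_eq0.
have xyz : 0 ^+ 2 + 1 ^+ 2 + i ^+ 2 = 0 * 1 * i.
  by rewrite i2 expr0n expr1n mul0r mul0r add0r subrr.
have z0' : 2%:R * i != 0 by rewrite mulf_neq0.
have xyz' : 2%:R ^+ 2 + 0 ^+ 2 + (2%:R * i) ^+ 2 = 2%:R * 0 * (2%:R * i).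
  by rewrite exprMn i2 expr0n addr0 mulrN1 subrr mulr0 mul0r.
have p6 : ~~ (p %| 6)%N.
  by rewrite (_ : 6 = 2 * 3)%N // Euclid_dvdM // !gtnNdvd //; lia.
have s1 : (-1) ^+ 2 = 1 :> F by rewrite sqrrN expr1n.
have [e pe [q eA]] := congruence_twist_scalar cong p_pr (isT : 0 < 6)%N p6
  i0 xyz s1 (expr6_tr0 (det_Jorgensen_a i0 xyz) (tr_Jorgensen_a _ _ _))
  (expr1n _ 2) (expr6_tr1 (det_Jorgensen_b i0 xyz) (tr_Jorgensen_b _ _ _))
  z0' xyz' n2.
(* The matrix has trace 2 and lower left entry 2, so its [e]-th power has lower left entry [2e];
   this vanishes in a scalar matrix, whence [p] divides [e]. *)
move/negP: pe; apply; rewrite -Fp_nat.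
have := congr1 (fun M : 'M_2 => M ord_max ord0) eA.
rewrite expr_parabolic ?det_Jorgensen_a ?tr_Jorgensen_a // !mxE /= !mulr0n subr0.
by move/eqP; rewrite mulf_eq0 (negPf n2) orbF.
Qed.

Lemma noncongruence_3mod4 : (p %% 4 = 3)%N -> noncongruence (M_PSL2_m2_abs p).
Proof.
move=> p4 cong; have cF := card_Fp p_pr; have nF := Fp_nat.
have [w [v /= [v0 v1 z0 xyz]]] := hyperbolic_Markoff p_pr p5 cF nF p4.
have [x' [y' [z' [z0' x0' xyz' nonsq]]]] := elliptic_Markoff p_pr p5 cF nF p4.
have n2 := Fp_two.
have r0 : (0 < p.-1./2)%N by lia.
have r2 : ~~ (2 %| p.-1./2)%N by lia.
have half (a : F) : a != 0 -> (a ^+ p.-1./2) ^+ 2 = 1.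
  move=> a0; rewrite -exprM (_ : (p.-1./2 * 2)%N = p.-1); last by lia.
  exact: (expf_pred p_pr cF a0).
(* The first trace is [2 + 1/2], so 2 is an eigenvalue; it differs from its inverse because 3 is
   nonzero. *)
have two1 : 2%:R ^+ 2 != 1 :> F.
  by rewrite -subr_eq0 -natrX -(natrB _ (isT : 1 <= 2 ^ 2)%N) (small_natF nF) //; lia.
have [e pe [q eA]] := congruence_twist_scalar cong (isT : prime 2) r0 r2
  z0 xyz (half _ n2)
  (expr_hyperbolic (det_Jorgensen_a z0 xyz) n2 two1 (tr_Jorgensen_a _ _ _) (half _ n2) erefl)
  (half _ v0)
  (expr_hyperbolic (det_Jorgensen_b z0 xyz) v0 v1 (tr_Jorgensen_b _ _ _) (half _ v0) erefl)
  z0' xyz' x0'.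
rewrite dvdn2 negbK in pe.
have [s] := odd_power_scalar pe (det_Jorgensen_a z0' xyz') eA.
by rewrite tr_Jorgensen_a; case: (nonsq s) => [n1 n1'] [].
Qed.

End Noncongruence.

Theorem corollary5p6p8 (p : nat) (hp : P_MP p) :
  noncongruence (M_PSL2_m2_abs p) /\ noncongruence (M_SL2_m2_abs p).
Proof.
case: hp => p_pr p5 _ _.
suff nc : noncongruence (M_PSL2_m2_abs p).
  by split=> // /congruence_cover_PSL2.
have [p1|p3] : (p %% 4 = 1)%N \/ (p %% 4 = 3)%N.
- have : odd p by have [p2|] := even_prime p_pr; first by rewrite p2 in p5.
  lia.
- exact: noncongruence_1mod4.
- exact: noncongruence_3mod4.
Qed.
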